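(* For every integer $k\geq 2$, $\mathsf{CERTAINTY}(\mathcal{AC}_k)$ is in $\mathbf{P}$, where $\mathcal{AC}_k=\{R_1(\underline{x_1},x_2), R_2(\underline{x_2},x_3),\dots,R_{k-1}(\underline{x_{k-1}},x_k), R_k(\underline{x_k},x_1), S_k(\underline{x_1,x_2,\dots,x_k})\}$ with $x_1,\dots,x_k$ distinct variables, $R_1,\dots,R_k,S_k$ distinct relation names, each $R_i$ of signature $[2,1]$ (first position is the primary key) and $S_k$ of signature $[k,k]$ (all positions form the primary key).
   Context: A relation name with signature $[n,k]$ has arity $n$ and primary key formed by positions $1,\dots,k$ (underlined). A fact is an atom with only constants; two facts are key-equal if they have the same relation name and agree on the primary-key positions. An uncertain database is a finite set of facts; a repair is a maximal subset containing no two distinct key-equal facts. A Boolean conjunctive query is a finite set of atoms, read as the existential closure of their conjunction; a database satisfies it if some assignment of constants to its variables maps every atom into the database. For a Boolean conjunctive query $q$, $\mathsf{CERTAINTY}(q)$ is the decision problem (with $q$ fixed) that asks, given an uncertain database ${\mathbf{db}}$, whether every repair of ${\mathbf{db}}$ satisfies $q$. *)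

(* Defs.v *)
From mathcomp Require Import all_boot.
Set Implicit Arguments. Unset Strict Implicit. Unset Printing Implicit Defensive.

(* Constants and relation names are natural numbers.  A fact R(c_1..c_n)
   is the pair (R, [:: c_1; ...; c_n]).  An atom R(x_1..x_n) (all terms of
   the queries considered here are variables, numbered by nat) has the same
   shape, the list holding variables. *)
Definition fact := (nat * seq nat)%type.
Definition atom := (nat * seq nat)%type.
Definition query := seq atom.

(* A signature assigns to each relation name its (arity, key length). *)
Definition signature := nat -> (nat * nat).

Definition key_equal (sg : signature) (f g : fact) : bool :=
  (f.1 == g.1) && (take (sg f.1).2 f.2 == take (sg g.1).2 g.2).

Definition consistent (sg : signature) (r : seq fact) : Prop :=
  forall f g, f \in r -> g \in r -> key_equal sg f g -> f = g.

Definition repair (sg : signature) (db r : seq fact) : Prop :=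
  [/\ {subset r <= db}, consistent sg r &
      forall r' : seq fact, {subset r <= r'} -> {subset r' <= db} ->
        consistent sg r' -> {subset r' <= r}].

Definition satisfies (db : seq fact) (q : query) : Prop :=
  exists v : nat -> nat, forall a, a \in q -> (a.1, map v a.2) \in db.

Definition certain (sg : signature) (q : query) (db : seq fact) : Prop :=
  forall r, repair sg db r -> satisfies r q.

Definition well_typed (sg : signature) (rels : seq nat) (db : seq fact) : Prop :=
  forall f, f \in db -> f.1 \in rels /\ size f.2 = (sg f.1).1.

Inductive move := MoveL | MoveR | Stay.

(* Finitely many states 'I_nq.+1 (start state ord0) and tape symbols
   'I_ns.+3 (0 = blank, 1 = bit false, 2 = bit true).  [delta] returning
   None means the machine halts; it then accepts iff [acc] holds of its
   state.  The tape is two-way infinite. *)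
Record TM := {
  tm_nq : nat;
  tm_ns : nat;
  tm_delta : 'I_tm_nq.+1 -> 'I_tm_ns.+3 ->
             option ('I_tm_nq.+1 * 'I_tm_ns.+3 * move);
  tm_acc : 'I_tm_nq.+1 -> bool }.

Section TMsem.
Variable M : TM.
Local Notation St := 'I_(tm_nq M).+1.
Local Notation Sy := 'I_(tm_ns M).+3.

(* state, cells left of the head (nearest first), scanned cell, cells right *)
Definition config := (St * seq Sy * Sy * seq Sy)%type.

Definition blank : Sy := ord0.
Definition bitsym (b : bool) : Sy := inord (if b then 2 else 1).

Definition step (c : config) : option config :=
  let: (q, l, a, r) := c in
  match tm_delta q a with
  | None => None
  | Some (q', b, m) =>
      Some (match m with
            | Stay => (q', l, b, r)
            | MoveL => match l with
                       | [::] => (q', [::], blank, b :: r)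
                       | x :: l' => (q', l', x, b :: r)
                       end
            | MoveR => match r with
                       | [::] => (q', b :: l, blank, [::])
                       | x :: r' => (q', b :: l, x, r')
                       end
            end)
  end.

Fixpoint run (t : nat) (c : config) : config :=
  match t with
  | 0 => c
  | t'.+1 => match step c with None => c | Some c' => run t' c' end
  end.

Definition init (w : seq bool) : config :=
  match w with
  | [::] => (ord0, [::], blank, [::])
  | b :: w' => (ord0, [::], bitsym b, map bitsym w')
  end.

Definition decides_within (w : seq bool) (t : nat) (P : Prop) : Prop :=
  let c := run t (init w) in
  step c = None /\ (tm_acc c.1.1.1 = true <-> P).
End TMsem.

Fixpoint bits_aux (fuel n : nat) : seq bool :=
  match fuel with
  | 0 => [::]
  | f.+1 => if n is 0 then [::] else odd n :: bits_aux f n./2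
  end.
Definition bits (n : nat) : seq bool := bits_aux n n.

(* self-delimiting list encoding: each element prefixed by true, end by false *)
Definition enc_list (T : Type) (e : T -> seq bool) (s : seq T) : seq bool :=
  flatten (map (fun x => true :: e x) s) ++ [:: false].

Definition enc_nat (n : nat) : seq bool := enc_list (fun b => [:: b]) (bits n).
Definition enc_fact (f : fact) : seq bool := enc_list enc_nat (f.1 :: f.2).
Definition enc_db (db : seq fact) : seq bool := enc_list enc_fact db.

Definition certainty_in_P (sg : signature) (rels : seq nat) (q : query) : Prop :=
  exists (M : TM) (c d : nat),
    forall db : seq fact, well_typed sg rels db ->
      decides_within M (enc_db db) (c * (size (enc_db db)) ^ d + c)
                     (certain sg q db).

(* Variable x_i is numbered i (1 <= i <= k).  Relation name R_i is i
   (1 <= i <= k), and S_k is 0. *)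
Definition ACq (k : nat) : query :=
  (0, iota 1 k) :: [seq (i, [:: i; (i %% k).+1]) | i <- iota 1 k].

Definition AC_sig (k : nat) : signature :=
  fun R => if R == 0 then (k, k) else (2, 1).

Definition AC_rels (k : nat) : seq nat := iota 0 k.+1.

(* Main.v *)
(* A falsifying repair picks one outgoing edge R_i(a, b) at every vertex (i, a) so
   that no cycle x_1, ..., x_k with S_k(x_1, ..., x_k) in the database is
   created.  It exists iff from every vertex one can reach a vertex without
   outgoing edge, or an elementary cycle that is longer than k or whose tuple is
   not in S_k: every other vertex can then be routed towards such a place without
   closing a new cycle.  An elementary cycle of length at least k is detected as
   a path of length k from x_1 together with a return path avoiding x_2, ..., x_k,
   so the criterion is a first-order formula with reachability over the positions
   of the input word.  Such formulas are evaluated in polynomial time by a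
   one-tape machine whose cells carry a fixed number of binary tracks, one for
   the pebble or the set of positions denoted by each variable. *)

Require Import Defs.
From mathcomp Require Import all_boot.
From mathcomp Require Import zify.
From Stdlib Require Import Classical.
Set Implicit Arguments. Unset Strict Implicit. Unset Printing Implicit Defensive.

(** * Machine fragments *)

(** The graph has facts as nodes, because a fact has a position in the input word; a vertex is the
    [source] shared by a block of facts, and an elementary cycle is one whose sources are distinct.
    Relation names advance by one modulo [k] along a walk. Hence every cycle has length divisible by
    [k], and [k] consecutive facts have distinct sources without any test. An arbitrary return walk
    that avoids [k.-1] fixed sources can be shortened to an elementary one, so plain reachability
    with a fixed number of parameters is enough; no search for simple paths is involved.

    The obstacle on the machine side is that finite control can hold neither a position nor a
    constant. Everything unbounded therefore lives on tracks, and even equality of two constants is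
    a loop that moves two pebbles in parallel. Every primitive is a full sweep over the word, and
    the nesting depth of the loops depends only on [k]; this gives the polynomial bound. *)

Section Fragments.
Variable G : finType.

Definition tape := (seq (option G) * option G * seq (option G))%type.

Definition write (b : option G) (mv : move) (t : tape) : tape :=
  let: (l, _, r) := t in
  match mv with
  | Stay => (l, b, r)
  | MoveL => if l is x :: l' then (l', x, b :: r) else ([::], None, b :: r)
  | MoveR => if r is x :: r' then (b :: l, x, r') else (b :: l, None, [::])
  end.

(* A program fragment: a register value of type A selects the start state,
   and reaching a state with [fr_exit q = Some b] returns b. *)
Record frag (A B : Type) := Frag {
  fr_state : finType;
  fr_start : A -> fr_state;
  fr_exit : fr_state -> option B;
  fr_delta : fr_state -> option G -> fr_state * option G * move }.

Definition fnext A B (F : frag A B) (c : fr_state F * tape) :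
    option (fr_state F * tape) :=
  if fr_exit c.1 is Some _ then None
  else let: (q, b, mv) := fr_delta c.1 c.2.1.2 in Some (q, write b mv c.2).

Definition steps A B (F : frag A B) n c c' :=
  iter n (obind (@fnext A B F)) (Some c) = Some c'.

Lemma steps_trans A B (F : frag A B) n m c1 c2 c3 :
  steps n c1 c2 -> steps m c2 c3 -> @steps A B F (m + n) c1 c3.
Proof. by rewrite /steps iterD => -> ->. Qed.

Lemma steps_sim A B A' B' (F : frag A B) (F' : frag A' B')
    (e : fr_state F -> fr_state F') n c c' :
  (forall d d', fnext d = Some d' -> fnext (e d.1, d.2) = Some (e d'.1, d'.2)) ->
  steps n c c' -> steps n (e c.1, c.2) (e c'.1, c'.2).
Proof.
move=> sim; elim: n c' => [|n IHn] c'; first by move=> [<-].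
rewrite /steps iterS; case E: (iter _ _ _) => [d|] //= dc'.
by rewrite [X in obind _ X](IHn _ E) /=; apply: sim.
Qed.

Definition runs A B (F : frag A B) (s : A * tape) (T : nat) (s' : B * tape) :=
  exists n q, [/\ n <= T, steps n (fr_start F s.1, s.2) (q, s'.2)
                & fr_exit q = Some s'.1].

Lemma runs_le A B (F : frag A B) s T T' s' :
  T <= T' -> runs F s T s' -> runs F s T' s'.
Proof. by move=> le [n [q [h1 h2 h3]]]; exists n, q; split=> //; apply: leq_trans le. Qed.

Definition fret A (B : finType) (f : A -> B) : frag A B :=
  @Frag A B B f Some (fun q a => (q, a, Stay)).

Lemma runs_ret A (B : finType) (f : A -> B) a t : runs (fret f) (a, t) 0 (f a, t).
Proof. by exists 0, (f a). Qed.

Definition fseq A B C (F1 : frag A B) (F2 : frag B C) : frag A C :=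
  @Frag A C (fr_state F1 + fr_state F2)%type
    (fun a => inl (fr_start F1 a))
    (fun q => if q is inr q2 then fr_exit q2 else None)
    (fun q a => match q with
      | inl q1 => if fr_exit q1 is Some b then (inr (fr_start F2 b), a, Stay)
                  else let: (q', b, mv) := fr_delta q1 a in (inl q', b, mv)
      | inr q2 => let: (q', b, mv) := fr_delta q2 a in (inr q', b, mv)
      end).

Lemma write_stay t : write t.1.2 Stay t = t.
Proof. by case: t => [[l a] r]. Qed.

Lemma runs_seq A B C (F1 : frag A B) (F2 : frag B C) s1 s2 s3 T1 T2 :
  runs F1 s1 T1 s2 -> runs F2 s2 T2 s3 -> runs (fseq F1 F2) s1 (T1 + T2).+1 s3.
Proof.
move=> [n1 [q1 [le1 st1 ex1]]] [n2 [q2 [le2 st2 ex2]]].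
exists (n2 + (1 + n1)), (inr q2); split=> //; first by lia.
have st1' : @steps _ _ (fseq F1 F2) n1 (inl (fr_start F1 s1.1), s1.2) (inl q1, s2.2).
  apply: (@steps_sim _ _ _ _ F1 (fseq F1 F2) inl _ _ _ _ st1) => -[q t] d'.
  rewrite /fnext /=; case: (fr_exit q) => //.
  by case: (fr_delta q _) => [[q' b] mv] [<-].
have st2' : @steps _ _ (fseq F1 F2) n2 (inr (fr_start F2 s2.1), s2.2) (inr q2, s3.2).
  apply: (@steps_sim _ _ _ _ F2 (fseq F1 F2) inr _ _ _ _ st2) => -[q t] d'.
  rewrite /fnext /=; case: (fr_exit q) => //.
  by case: (fr_delta q _) => [[q' b] mv] [<-].
apply: steps_trans st2'; apply: steps_trans st1' _.
by rewrite /steps /= /fnext /= ex1 write_stay.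
Qed.

Definition fcase A1 A2 B (F1 : frag A1 B) (F2 : frag A2 B) : frag (A1 + A2) B :=
  @Frag (A1 + A2) B (fr_state F1 + fr_state F2)%type
    (fun a => match a with inl a1 => inl (fr_start F1 a1)
                         | inr a2 => inr (fr_start F2 a2) end)
    (fun q => match q with inl q1 => fr_exit q1 | inr q2 => fr_exit q2 end)
    (fun q a => match q with
      | inl q1 => let: (q', b, mv) := fr_delta q1 a in (inl q', b, mv)
      | inr q2 => let: (q', b, mv) := fr_delta q2 a in (inr q', b, mv)
      end).

Lemma runs_casel A1 A2 B (F1 : frag A1 B) (F2 : frag A2 B) a t T s' :
  runs F1 (a, t) T s' -> runs (fcase F1 F2) (inl a, t) T s'.
Proof.
move=> [n [q [le st ex]]]; exists n, (inl q); split=> //.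
have := @steps_sim _ _ _ _ F1 (fcase F1 F2) inl _ _ _ _ st; apply => -[q1 t1] d'.
rewrite /fnext /=; case: (fr_exit q1) => //.
by case: (fr_delta q1 _) => [[q' b] mv] [<-].
Qed.

Lemma runs_caser A1 A2 B (F1 : frag A1 B) (F2 : frag A2 B) a t T s' :
  runs F2 (a, t) T s' -> runs (fcase F1 F2) (inr a, t) T s'.
Proof.
move=> [n [q [le st ex]]]; exists n, (inr q); split=> //.
have := @steps_sim _ _ _ _ F2 (fcase F1 F2) inr _ _ _ _ st; apply => -[q1 t1] d'.
rewrite /fnext /=; case: (fr_exit q1) => //.
by case: (fr_delta q1 _) => [[q' b] mv] [<-].
Qed.

Definition floop A B (F : frag A (A + B)) : frag A B :=
  @Frag A B (fr_state F) (fr_start F)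
    (fun q => if fr_exit q is Some (inr b) then Some b else None)
    (fun q a => if fr_exit q is Some (inl x) then (fr_start F x, a, Stay)
                else fr_delta q a).

Lemma steps_loop A B (F : frag A (A + B)) n q t q' t' :
  @steps _ _ F n (q, t) (q', t') -> @steps _ _ (floop F) n (q, t) (q', t').
Proof.
move=> st; have := @steps_sim _ _ _ _ F (floop F) id _ _ _ _ st; apply => -[q1 t1] [q2 t2].
by rewrite /fnext /=; case: (fr_exit q1).
Qed.

Lemma runs_loop_stop A B (F : frag A (A + B)) s T b t :
  runs F s T (inr b, t) -> runs (floop F) s T (b, t).
Proof.
move=> [n [q [le /steps_loop st ex]]]; exists n, q; split=> //=.
by rewrite ex.
Qed.

Lemma runs_loop_step A B (F : frag A (A + B)) s T T' a t s' :
  runs F s T (inl a, t) -> runs (floop F) (a, t) T' s' ->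
  runs (floop F) s (T + T').+1 s'.
Proof.
move=> [n [q [le /steps_loop st ex]]] [n' [q' [le' st' ex']]].
exists (n' + (1 + n)), q'; split=> //; first by lia.
apply: steps_trans st'; apply: steps_trans st _.
by rewrite /steps /= /fnext /= ex; case: (t) => -[].
Qed.

(** Common resting position of all sweeps: the head is on the blank to the left of the word, so that
    runs compose. The trailing blank is the cell a sweep has visited beyond the word. *)
Definition tape_of (w : seq G) : tape := ([::], None, map Some w ++ [:: None]).

Fixpoint scan Q (tr : Q -> G -> Q * G) q w :=
  if w is g :: w' then
    let: (q1, g1) := tr q g in
    let: (q2, w2) := scan tr q1 w' in (q2, g1 :: w2)
  else (q, [::]).

(* One left-to-right pass of a transducer followed by a return to the left
   end; the two booleans of the state are the phase: start (false, false),
   scanning (true, false), returning (true, true), finished (false, true). *)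
Definition fsweep A B (Q : finType) (q0 : A -> Q) (tr : Q -> G -> Q * G)
    (out : Q -> B) : frag A B :=
  @Frag A B (bool * bool * Q)%type
    (fun a => (false, false, q0 a))
    (fun q => if q is (false, true, q1) then Some (out q1) else None)
    (fun q a => match q, a with
      | (false, _, q1), _ => (true, false, q1, a, MoveR)
      | (true, false, q1), Some g =>
          let: (q2, g') := tr q1 g in (true, false, q2, Some g', MoveR)
      | (true, false, q1), None => (true, true, q1, None, MoveL)
      | (true, true, q1), Some g => (q, a, MoveL)
      | (true, true, q1), None => (false, true, q1, None, Stay)
      end).

(** The first sweep finds no explicit cell behind the input, later sweeps find the blank left by
    their predecessor. Both shapes of [z] lead to the same [tape_of]. *)
Lemma runs_sweep_gen A B (Q : finType) (q0 : A -> Q) tr (out : Q -> B) a w z :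
  z = [::] \/ z = [:: None] ->
  let: (q, w') := scan tr (q0 a) w in
  runs (fsweep q0 tr out) (a, ([::], None, map Some w ++ z)) (2 * size w + 4)
    (out q, tape_of w').
Proof.
move=> hz; set F := fsweep q0 tr out.
pose rest (w : seq G) (l : seq (option G)) : tape :=
  if w is x :: w1 then (l, Some x, map Some w1 ++ z) else (l, None, [::]).
have fwd : forall w q l, let: (q', w') := scan tr q w in
    @steps _ _ F (size w) ((true, false, q), rest w l)
      ((true, false, q'), (rev (map Some w') ++ l, None, [::])).
  elim=> [|x w1 IH] q l //=.
  case E: (tr q x) => [q1 x1]; have := IH q1 (Some x1 :: l).
  case: (scan tr q1 w1) => [q2 w2] /= IH'.
  rewrite -addn1 rev_cons cat_rcons; apply: steps_trans IH'.
  rewrite /steps /= /fnext /= E /=.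
  by case: w1 {IH} => //=; case: hz => ->.
have bwd : forall w q r, 
    @steps _ _ F (size w) ((true, true, q), if w is x :: w1 then
       (map Some w1 ++ [:: None], Some x, r) else ([::], None, r))
      ((true, true, q), ([::], None, rev (map Some w) ++ r)).
  elim=> [|x w1 IH] q r //=.
  rewrite -addn1 rev_cons cat_rcons; apply: steps_trans (IH q (Some x :: r)).
  by rewrite /steps /= /fnext /=; case: w1 {IH}.
case E: (scan tr (q0 a) w) => [q w'].
have szw' : size w' = size w.
  elim: (w) (q0 a) (q) (w') E => [|x w1 IH] p p' w2 /=; first by case=> _ <-.
  case: (tr p x) => p1 x1; case E: (scan tr p1 w1) => [p2 w3] [_ <-] /=.
  by rewrite (IH _ _ _ E).
(* Read from the inside out: one step to enter the word, the scan, one step to turn, the way back,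
   one step to stop. *)
exists (1 + (size w' + (1 + (size w + 1)))), (false, true, q); split=> //.
  by rewrite szw'; lia.
apply: steps_trans (_ : @steps _ _ F 1 _ (false, true, q, tape_of w')).
  apply: steps_trans.
    apply: steps_trans.
      apply: steps_trans.
        have : @steps _ _ F 1 (fr_start F a, ([::], None, map Some w ++ z))
          ((true, false, q0 a), rest w [:: None]).
          rewrite /steps /= /fnext /= /rest.
          by case: (w) => //=; case: hz => ->.
        by apply.
      by have := fwd w (q0 a) [:: None]; rewrite E; apply.
    have : @steps _ _ F 1
        (true, false, q, (rev [seq Some i | i <- w'] ++ [:: None], None, [::]))
        ((true, true, q), if rev w' is x :: w1 then
       (map Some w1 ++ [:: None], Some x, [:: None]) else ([::], None, [:: None])).
      rewrite /steps /= /fnext /= -map_rev.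
      by case: (rev w').
    by apply.
  have := bwd (rev w') q [:: None].
  by rewrite size_rev -map_rev revK; apply.
by [].
Qed.

Lemma runs_sweep A B (Q : finType) (q0 : A -> Q) tr (out : Q -> B) a w q w' :
  scan tr (q0 a) w = (q, w') ->
  runs (fsweep q0 tr out) (a, tape_of w) (2 * size w + 4) (out q, tape_of w').
Proof.
by have := @runs_sweep_gen A B Q q0 tr out a w [:: None] (or_intror erefl) => /[swap] ->.
Qed.

(** The initial configuration scans the first input bit, whereas a sweep starts on the blank to its
    left. *)
Definition fleft : frag unit unit :=
  @Frag unit unit bool (fun _ => false) (fun q => if q then Some tt else None)
    (fun q a => (true, a, MoveL)).

Lemma runs_left x r : runs fleft (tt, ([::], x, r)) 1 (tt, ([::], None, x :: r)).
Proof. by exists 1, true. Qed.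

End Fragments.

(** * Encoding a fragment as a Turing machine *)

Section Compile.
Variables (G : finType) (raw : bool -> G) (F : frag G unit bool).
Hypothesis raw_inj : injective raw.

(** The machine model reserves the symbols 0, 1, 2 for the blank and the two bits, hence the three
    leading entries. Their repetition in the enumeration is harmless, since [index] returns the
    first occurrence. [tm_states] puts the start state at 0 in the same way. *)
Definition tm_syms : seq (option G) :=
  [:: None, Some (raw false), Some (raw true) & enum {: option G}].
Definition enc_sym (x : option G) : 'I_(size (enum {: option G})).+3 :=
  inord (index x tm_syms).
Definition dec_sym (i : 'I_(size (enum {: option G})).+3) := nth None tm_syms i.

Definition tm_states : seq (fr_state F) := fr_start F tt :: enum (fr_state F).
Definition enc_state (q : fr_state F) : 'I_(size (enum (fr_state F))).+1 :=
  inord (index q tm_states).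
Definition dec_state (i : 'I_(size (enum (fr_state F))).+1) :=
  nth (fr_start F tt) tm_states i.

Lemma enc_symK : cancel enc_sym dec_sym.
Proof.
move=> x; have h : x \in tm_syms by rewrite !inE mem_enum !orbT.
by rewrite /dec_sym /enc_sym inordK ?nth_index // -[X in _ < X]/(size tm_syms) index_mem.
Qed.

Lemma enc_stateK : cancel enc_state dec_state.
Proof.
move=> x; have h : x \in tm_states by rewrite !inE mem_enum orbT.
by rewrite /dec_state /enc_state inordK ?nth_index // -[X in _ < X]/(size tm_states) index_mem.
Qed.

Definition tm_of : TM :=
  @Build_TM (size (enum (fr_state F))) (size (enum {: option G}))
    (fun i a => if fr_exit (dec_state i) is Some _ then None else
       let: (q, b, mv) := fr_delta (dec_state i) (dec_sym a) in
       Some (enc_state q, enc_sym b, mv))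
    (fun i => fr_exit (dec_state i) == Some true).

Definition enc_conf (c : fr_state F * tape G) : config tm_of :=
  (enc_state c.1, map enc_sym c.2.1.1, enc_sym c.2.1.2, map enc_sym c.2.2).

Lemma enc_blank : enc_sym None = blank tm_of.
Proof. by apply: val_inj; rewrite /= inordK. Qed.

Lemma enc_bit b : enc_sym (Some (raw b)) = bitsym tm_of b.
Proof.
rewrite /bitsym /enc_sym /=; case: b; last by rewrite eqxx.
rewrite eqxx; case: eqP => // -[/raw_inj]; discriminate.
Qed.

Lemma step_enc c : step (enc_conf c) = omap enc_conf (fnext c).
Proof.
case: c => q [[l a] r]; rewrite /step /fnext /= enc_stateK enc_symK.
case: (fr_exit q) => //; case: (fr_delta q a) => [[q' b] []] //=.
  by case: l => [|x l]; rewrite /enc_conf /= ?enc_blank.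
by case: r => [|x r]; rewrite /enc_conf /= ?enc_blank.
Qed.

Lemma runS (M : TM) t (c : config M) :
  run t.+1 c = if step c is Some c' then run t c' else c.
Proof. by []. Qed.

Lemma run_enc n t c c' : steps n c c' -> fnext c' = None -> n <= t ->
  run t (enc_conf c) = enc_conf c'.
Proof.
elim: n t c => [|n IH] t c.
  by move=> [<-] h _; case: t => // t; rewrite runS step_enc h.
case: t => // t; rewrite /steps iterSr -[obind _ (Some c)]/(fnext c).
case E: (fnext c) => [d|]; last first.
  by have -> : iter n (obind (@fnext _ _ _ F)) None = None by elim: (n) => // m /= ->.
by move=> st h le; rewrite runS step_enc E; apply: IH.
Qed.

Lemma tm_of_decides (x : bool) w T b t (P : Prop) T' :
  runs F (tt, ([::], Some (raw x), map (Some \o raw) w)) T (b, t) ->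
  T <= T' -> (b = true <-> P) -> @decides_within tm_of (x :: w) T' P.
Proof.
move=> [n [q [le st ex]]] le' bP.
have nx : fnext (q, t) = None by rewrite /fnext /= ex.
rewrite /decides_within.
have -> : init tm_of (x :: w) =
    enc_conf (fr_start F tt, ([::], Some (raw x), map (Some \o raw) w)).
  rewrite /init /enc_conf /= enc_bit; congr (_, _, _, _).
    by apply: val_inj; rewrite /= /enc_state /= eqxx inordK.
  by rewrite -map_comp; apply: eq_map => y /=; rewrite enc_bit.
rewrite (run_enc st nx (leq_trans le le')) step_enc nx; split=> //.
by rewrite /= enc_stateK ex -bP; split=> [/eqP[]|->].
Qed.

End Compile.

(** * Evaluating formulas on a tape with tracks *)

(** With base [n.+1] instead of [n] the power is never 0, so exponents can be raised freely and
    closure under sums and products has no side condition. *)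
Definition poly (T : nat -> nat) := exists c e, forall n, T n <= c * n.+1 ^ e.

Lemma poly_const c : poly (fun=> c).
Proof. by exists c, 0 => n; rewrite muln1. Qed.

Lemma poly_id : poly id.
Proof. by exists 1, 1 => n; rewrite mul1n expn1. Qed.

Lemma poly_add S T : poly S -> poly T -> poly (fun n => S n + T n).
Proof.
move=> [c [e h]] [c' [e' h']]; exists (c + c'), (e + e') => n.
rewrite mulnDl expnD leq_add //.
  by apply: leq_trans (h n) _; rewrite mulnA leq_pmulr // expn_gt0.
by apply: leq_trans (h' n) _; rewrite mulnCA leq_pmull // expn_gt0.
Qed.

Lemma poly_mul S T : poly S -> poly T -> poly (fun n => S n * T n).
Proof.
move=> [c [e h]] [c' [e' h']]; exists (c * c'), (e + e') => n.
by rewrite expnD mulnACA leq_mul.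
Qed.

Lemma poly_le S T : (forall n, S n <= T n) -> poly T -> poly S.
Proof. by move=> le [c [e h]]; exists c, e => n; apply: leq_trans (h n). Qed.

Ltac poly_tac :=
  repeat first [assumption | exact: poly_id | exact: poly_const
               | apply: poly_add | apply: poly_mul].

(* A track of the tape holds a set of positions; a pebble is a track holding
   one position, or none when its position is beyond the end of the word. *)
Inductive track := Pos of nat | Mark of (nat -> bool).

Definition on_track e p := match e with Pos q => p == q | Mark X => X p end.
(** The result is [n] when the track has no mark below [n]; an empty track and a pebble beyond the
    word are thus read alike. *)
Definition first_on n e := find (on_track e) (iota 0 n).

Lemma first_on_posP n p : first_on n (Pos p) = minn p n.
Proof.
rewrite -[first_on _ _]/(index p (iota 0 n)); case: (ltnP p n) => h.
  rewrite -{1}[p](nth_iota 0 0 h) index_uniq ?iota_uniq ?size_iota //; lia.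
by rewrite memNindex ?size_iota ?mem_iota; lia.
Qed.

Lemma first_on_pos n p : p < n -> first_on n (Pos p) = p.
Proof. by rewrite first_on_posP => h; lia. Qed.

(** * Track contexts and formulas decided by fragments *)

Section Tracks.
Variables (L : finType) (l0 : L) (m : nat).

Definition sym : finType := (L * {ffun 'I_m.+1 -> bool})%type.
Definition cell (lab : seq L) (E : nat -> track) p : sym :=
  (nth l0 lab p, [ffun i : 'I_m.+1 => on_track (E i) p]).
Definition word lab E : seq sym := mkseq (cell lab E) (size lab).
Definition wtape lab E := tape_of (word lab E).
Definition upd (E : nat -> track) d X : nat -> track :=
  fun i => if i == d then X else E i.
(** Variables are de Bruijn levels: a fragment for a context of length [d] must preserve the tracks
    below [d] and may use the others as scratch space. *)
Definition agree d (E E' : nat -> track) := forall i, i < d -> E' i = E i.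

Lemma bit_cell lab E p i : i <= m -> (cell lab E p).2 (inord i) = on_track (E i) p.
Proof. by move=> le; rewrite ffunE inordK. Qed.

Lemma word_ext lab E E' :
  (forall i p, p < size lab -> on_track (E i) p = on_track (E' i) p) ->
  word lab E = word lab E'.
Proof.
move=> eqE; apply/eq_in_map => p; rewrite mem_iota /= => lt.
by congr (_, _); apply/ffunP => i; rewrite !ffunE eqE.
Qed.

Lemma upd_eq E d X : upd E d X d = X.
Proof. by rewrite /upd eqxx. Qed.

Lemma upd_ne E d X i : i != d -> upd E d X i = E i.
Proof. by rewrite /upd => /negPf->. Qed.

Lemma upd_lt E d X i : i < d -> upd E d X i = E i.
Proof. by move=> lt; apply: upd_ne; lia. Qed.

Lemma upd_gt E d X i : d < i -> upd E d X i = E i.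
Proof. by move=> lt; apply: upd_ne; lia. Qed.

Lemma agree_upd d d' E E' X : d <= d' -> agree d E E' -> agree d E (upd E' d' X).
Proof. by move=> le h i lt; rewrite upd_lt ?h //; lia. Qed.

Lemma agree_le d d' E E' : d <= d' -> agree d' E E' -> agree d E E'.
Proof. by move=> le h i lt; apply: h; lia. Qed.

Lemma agree_trans d E1 E2 E3 : agree d E1 E2 -> agree d E2 E3 -> agree d E1 E3.
Proof. by move=> h h' i lt; rewrite h' ?h. Qed.

Lemma agree_mkseq d E E' : agree d E E' -> mkseq E' d = mkseq E d.
Proof. by move=> h; apply/eq_in_map => i; rewrite mem_iota => /h. Qed.

Lemma mkseq_upd E d X : mkseq (upd E d X) d.+1 = rcons (mkseq E d) X.
Proof. by rewrite mkseqS upd_eq; congr rcons; apply: agree_mkseq; apply: agree_upd. Qed.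

Lemma scan_word Q (f : Q -> sym -> Q * sym) lab E E' (st : nat -> Q) :
  (forall p, p < size lab -> f (st p) (cell lab E p) = (st p.+1, cell lab E' p)) ->
  scan f (st 0) (word lab E) = (st (size lab), word lab E').
Proof.
move=> h; rewrite /word /mkseq.
suff gen b a : a + b <= size lab ->
    scan f (st a) (map (cell lab E) (iota a b)) =
      (st (a + b), map (cell lab E') (iota a b)) by rewrite gen.
elim: b a => [|b IH] a le /=; first by rewrite addn0.
by rewrite h ?IH ?addSnnS //; lia.
Qed.

Definition fupd A B (Q : finType) (d : nat) (q0 : A -> Q)
    (t : Q -> L -> {ffun 'I_m.+1 -> bool} -> Q * bool) (out : Q -> B) :=
  @fsweep sym A B Q q0
    (fun q g => let: (q', b) := t q g.1 g.2 in
       (q', (g.1, [ffun i : 'I_m.+1 => if i == d :> nat then b else g.2 i]))) out.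

(** [st p] is the control state on arrival at cell [p]. A sweep is thereby specified by a closed
    formula for its state and for the new track, and no further induction over the word is
    needed. *)
Lemma runs_upd A B (Q : finType) d (q0 : A -> Q) t (out : Q -> B) lab E X st a T :
  st 0 = q0 a ->
  (forall p, p < size lab ->
     t (st p) (nth l0 lab p) (cell lab E p).2 = (st p.+1, on_track X p)) ->
  2 * size lab + 4 <= T ->
  runs (fupd d q0 t out) (a, wtape lab E) T
    (out (st (size lab)), wtape lab (upd E d X)).
Proof.
move=> st0 h; have -> : size lab = size (word lab E) by rewrite size_mkseq.
move=> le; apply: (runs_le le); apply: runs_sweep.
rewrite -st0 size_mkseq; apply: scan_word => p lt; rewrite [fst _]/= h //.
congr (_, (_, _)); apply/ffunP => i; rewrite !ffunE /upd.
by case: eqP.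
Qed.

Arguments runs_upd {A B Q d q0 t out lab E X} st {a T}.

(** The environment [E] is arbitrary from level [d] on, so no fragment has to clean up the scratch
    tracks left by another one. *)
Definition dec d (phi : seq L -> seq track -> bool) :=
  exists (F : frag sym unit bool) T, poly T /\ forall lab E, exists E',
    agree d E E' /\
    runs F (tt, wtape lab E) (T (size lab)) (phi lab (mkseq E d), wtape lab E').

Definition defines d (X : seq L -> seq track -> track) :=
  exists (F : frag sym unit unit) T, poly T /\ forall lab E, exists E',
    [/\ agree d E E', E' d = X lab (mkseq E d) &
        runs F (tt, wtape lab E) (T (size lab)) (tt, wtape lab E')].

Definition at_ (s : seq track) i := nth (Pos 0) s i.
Definition pos_at n s i := first_on n (at_ s i).

Lemma at_mkseq E d i : i < d -> at_ (mkseq E d) i = E i.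
Proof. by move=> lt; rewrite /at_ nth_mkseq. Qed.

Lemma dec_ext d phi psi : (forall lab s, size s = d -> phi lab s = psi lab s) ->
  dec d phi -> dec d psi.
Proof.
move=> eq [F [T [pT h]]]; exists F, T; split=> // lab E.
by rewrite -eq ?size_mkseq.
Qed.

Lemma dec_const d b : dec d (fun _ _ => b).
Proof.
exists (fret sym (fun=> b)), (fun=> 0); split; first exact: poly_const.
by move=> lab E; exists E; split=> //; apply: runs_ret.
Qed.

Lemma dec_not d phi : dec d phi -> dec d (fun lab s => ~~ phi lab s).
Proof.
move=> [F [T [pT h]]]; exists (fseq F (fret sym negb)), (fun n => T n + 1).
split=> [|lab E]; first by poly_tac.
have [E' [ag r]] := h lab E; exists E'; split=> //.
by rewrite addn1 -[T _]addn0; apply: runs_seq r (runs_ret _ _ _).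
Qed.

Lemma dec_and d phi psi : dec d phi -> dec d psi ->
  dec d (fun lab s => phi lab s && psi lab s).
Proof.
move=> [F [T [pT h]]] [F' [T' [pT' h']]].
pose br (b : bool) : unit + unit := if b then inl tt else inr tt.
exists (fseq F (fseq (fret sym br) (fcase F' (fret sym (fun _ : unit => false))))).
exists (fun n => T n + T' n + 2).
split=> [|lab E]; first by poly_tac.
have [E1 [ag1 r1]] := h lab E; have [E2 [ag2 r2]] := h' lab E1.
rewrite (agree_mkseq ag1) in r2.
case: (phi lab _) r1 => r1.
  exists E2; split; first exact: agree_trans ag2.
  have := runs_seq r1 (runs_seq (runs_ret br true _) (runs_casel (fret sym (fun _ : unit => false)) r2)).
  by apply: runs_le; lia.
exists E1; split=> //.
have := runs_seq r1 (runs_seq (runs_ret br false _)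
  (runs_caser F' (runs_ret (fun _ : unit => false) tt _))).
by apply: runs_le; lia.
Qed.

Lemma dec_or d phi psi : dec d phi -> dec d psi ->
  dec d (fun lab s => phi lab s || psi lab s).
Proof.
move=> h h'; apply: dec_ext (dec_not (dec_and (dec_not h) (dec_not h'))).
by move=> lab s _; rewrite -negb_or negbK.
Qed.

Lemma dec_has (I : eqType) (r : seq I) d phi : (forall i, i \in r -> dec d (phi i)) ->
  dec d (fun lab s => has (fun i => phi i lab s) r).
Proof.
elim: r => [|i r IH] h; first exact: dec_const.
apply: dec_or; first by apply: h; rewrite mem_head.
by apply: IH => j jr; apply: h; rewrite inE jr orbT.
Qed.

Lemma dec_all (I : eqType) (r : seq I) d phi : (forall i, i \in r -> dec d (phi i)) ->
  dec d (fun lab s => all (fun i => phi i lab s) r).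
Proof.
elim: r => [|i r IH] h; first exact: dec_const.
apply: dec_and; first by apply: h; rewrite mem_head.
by apply: IH => j jr; apply: h; rewrite inE jr orbT.
Qed.

Lemma dec_common d i j P : i < d -> j < d -> d <= m.+1 ->
  dec d (fun lab s => has (fun p => [&& on_track (at_ s i) p, on_track (at_ s j) p
                                     & P (nth l0 lab p)]) (iota 0 (size lab))).
Proof.
move=> lti ltj led.
(* A sweep of this kind has to write some track; here it copies track 0 onto itself. *)
exists (fupd 0 (fun _ : unit => false)
  (fun q l f => (q || [&& f (inord i), f (inord j) & P l], f (inord 0))) id).
exists (fun n => 2 * n + 4); split; first by poly_tac.
move=> lab E; exists (upd E 0 (E 0)); split.
  by move=> x _; rewrite /upd; case: eqP => [->|].
apply: (runs_upd (fun p => has (fun p => [&& on_track (at_ (mkseq E d) i) p,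
  on_track (at_ (mkseq E d) j) p & P (nth l0 lab p)]) (iota 0 p))) => // p ltp.
rewrite !bit_cell //; try lia.
by rewrite -addn1 iotaD has_cat /= add0n orbF !at_mkseq.
Qed.

Lemma dec_let d X phi : defines d X -> dec d.+1 phi ->
  dec d (fun lab s => phi lab (rcons s (X lab s))).
Proof.
move=> [F [T [pT h]]] [F' [T' [pT' h']]].
exists (fseq F F'), (fun n => T n + T' n + 1); split; first by poly_tac.
move=> lab E; have [E1 [ag1 e1 r1]] := h lab E; have [E2 [ag2 r2]] := h' lab E1.
exists E2; split; first by apply: agree_trans ag1 _; apply: agree_le ag2.
rewrite mkseqS e1 (agree_mkseq ag1) in r2.
by rewrite addn1; apply: runs_seq r1 r2.
Qed.

(** * Loops over the positions of the word *)

Section For.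
Variables (A : finType) (d : nat) (F : frag sym A A).

Definition ffor_init : frag sym A A :=
  fupd d (fun a => (a, true)) (fun q l f => ((q.1, false), q.2)) fst.
Definition ffor_test : frag sym A (A + A) :=
  fupd d (fun a => (a, false)) (fun q l f => ((q.1, q.2 || f (inord d)), f (inord d)))
    (fun q => if q.2 then inl q.1 else inr q.1).
Definition ffor_next : frag sym A (A + A) :=
  fupd d (fun a => (a, false)) (fun q l f => ((q.1, f (inord d)), q.2))
    (fun q => inl q.1).
(** The loop counter ranges over positions, so it is the pebble on track [d] and not a register. The
    loop ends once a shift has pushed it off the word. *)
Definition ffor : frag sym A A :=
  fseq ffor_init (floop (fseq ffor_test (fcase (fseq F ffor_next) (fret sym inr)))).

Lemma runs_for (I : nat -> A -> (nat -> track) -> Prop) lab T :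
  d <= m ->
  (forall z a E, z < size lab -> I z a E -> exists a' E',
     [/\ runs F (a, wtape lab (upd E d (Pos z))) T (a', wtape lab E'),
         E' d = Pos z & I z.+1 a' E']) ->
  forall a E, I 0 a E -> exists a' E',
    runs ffor (a, wtape lab E) ((size lab).+2 * (T + 4 * size lab + 20))
      (a', wtape lab (upd E' d (Pos (size lab)))) /\ I (size lab) a' E'.
Proof.
move=> led step a E I0; set n := size lab.
(* [U] bounds one round: the body, a test and a shift of [2 * n + 4] steps each, and the hand-overs.
   There are [n] full rounds, a last failing test, and the initialization, hence the factor
   [n.+2]. *)
pose U := T + 4 * size lab + 20.
have test z a1 E1 : runs ffor_test (a1, wtape lab (upd E1 d (Pos z))) (2 * n + 4)
    (if z < n then inl a1 else inr a1, wtape lab (upd E1 d (Pos z))).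
  have eqw : wtape lab (upd (upd E1 d (Pos z)) d (Pos z)) = wtape lab (upd E1 d (Pos z)).
    congr tape_of; apply: word_ext => i p _; rewrite {1}/upd.
    by case: eqP => // ->; rewrite upd_eq.
  rewrite -{2}eqw; apply: (runs_upd (fun p => (a1, z < p))) => // p ltp.
  rewrite bit_cell // upd_eq /=; congr (_, _, _); lia.
have next z a1 E1 : E1 d = Pos z -> runs ffor_next (a1, wtape lab E1) (2 * n + 4)
    (inl a1, wtape lab (upd E1 d (Pos z.+1))).
  move=> e; apply: (runs_upd (fun p => (a1, p == z.+1))) => // p ltp.
  by rewrite bit_cell // e /=.
have loop r : forall z a1 E1, z + r = n -> I z a1 E1 -> exists a' E',
    runs (floop (fseq ffor_test (fcase (fseq F ffor_next) (fret sym inr))))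
      (a1, wtape lab (upd E1 d (Pos z))) (r.+1 * U)
      (a', wtape lab (upd E' d (Pos n))) /\ I n a' E'.
  elim: r => [|r IH] z a1 E1 zr Iz.
    have {}zr : z = n by lia.
    exists a1, E1; split; last by rewrite -zr.
    apply: (@runs_le _ _ _ _ _ (2 * n + 4 + 0).+1); first by rewrite /U; lia.
    apply: runs_loop_stop; have := test z a1 E1; rewrite zr ltnn => t.
    by apply: runs_seq t _; apply: runs_caser; apply: runs_ret.
  have zn : z < n by lia.
  have [a2 [E2 [r2 e2 I2]]] := step _ _ _ zn Iz.
  have [a3 [E3 [r3 I3]]] := IH z.+1 a2 E2 ltac:(lia) I2.
  exists a3, E3; split=> //.
  have t := test z a1 E1; rewrite zn in t.
  have := runs_loop_step (runs_seq t (runs_casel (fret sym inr) (runs_seq r2 (next _ _ _ e2)))) r3.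
  by apply: runs_le; rewrite [r.+2 * U]mulSn /U; lia.
have [a' [E' [r' I']]] := loop n 0 a E (add0n _) I0.
exists a', E'; split=> //.
have init : runs ffor_init (a, wtape lab E) (2 * n + 4) (a, wtape lab (upd E d (Pos 0))).
  apply: (runs_upd (fun p => (a, p == 0))) => // p ltp.
have := runs_seq init r'; apply: runs_le.
by rewrite -/n -/U [n.+2 * U]mulSn /U; lia.
Qed.

End For.

Lemma poly_for T : poly T -> poly (fun n => n.+2 * (T n + 4 * n + 20)).
Proof.
move=> pT; have e n : n.+2 = n + 2 by lia.
by apply: (@poly_le _ (fun n => (n + 2) * (T n + 4 * n + 20))) => [n|];
  [rewrite e | poly_tac].
Qed.

Lemma dec_ex d phi : d <= m -> dec d.+1 phi ->
  dec d (fun lab s => has (fun p => phi lab (rcons s (Pos p))) (iota 0 (size lab))).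
Proof.
move=> led [F [T [pT h]]].
pose br (b : bool) : unit + unit := if b then inl tt else inr tt.
pose F' := fseq (fret sym br) (fcase (fret sym (fun _ : unit => true)) F).
exists (fseq (fret sym (fun _ : unit => false)) (ffor d F')).
exists (fun n => n.+2 * (T n + 1 + 4 * n + 20) + 1); split.
  by apply: poly_add (poly_const _); apply: (@poly_for (fun n => T n + 1)); poly_tac.
move=> lab E.
pose I z b E1 := agree d E E1 /\
  b = has (fun p => phi lab (rcons (mkseq E d) (Pos p))) (iota 0 z).
have [||b [E' [r [ag e]]]] := @runs_for _ d F' I lab (T (size lab) + 1) led _ false E.
- move=> z b E1 ltz [ag e].
  have eI : has (fun p => phi lab (rcons (mkseq E d) (Pos p))) (iota 0 z.+1) =
      b || phi lab (rcons (mkseq E d) (Pos z)).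
    by rewrite e -addn1 iotaD has_cat /= orbF add0n.
  case: b e eI => e eI.
    exists true, (upd E1 d (Pos z)); split; last 1 first.
    + by split; [apply: agree_upd | rewrite eI].
    + have := runs_seq (runs_ret br true (wtape lab (upd E1 d (Pos z))))
        (runs_casel F (runs_ret (fun _ : unit => true) tt _)).
      by apply: runs_le; lia.
    + by rewrite upd_eq.
  have [E2 [ag2 r2]] := h lab (upd E1 d (Pos z)).
  rewrite mkseq_upd (agree_mkseq ag) in r2.
  exists (phi lab (rcons (mkseq E d) (Pos z))), E2; split.
  + have := runs_seq (runs_ret br false (wtape lab (upd E1 d (Pos z))))
      (runs_caser (fret sym (fun _ : unit => true)) r2).
    by apply: runs_le; lia.
  + by rewrite ag2 // upd_eq.
  + split; last by rewrite eI.
    apply: agree_trans ag _; apply: agree_trans (agree_le (leqnSn d) ag2).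
    exact: agree_upd.
- by split.
exists (upd E' d (Pos (size lab))); split; first exact: agree_upd.
rewrite -e; have := runs_seq (runs_ret (fun _ : unit => false) tt _) r.
by apply: runs_le; rewrite -addn1 add0n.
Qed.

(** Expresses the answer at [k] by the cell at [k] and one bit about the cells before it, which is
    all a left-to-right transducer knows; [find_ltS] tells how this bit is updated. *)
Lemma find_eqP (T : Type) (x0 : T) a s k : k < size s ->
  (k == find a s) = ~~ (find a s < k) && a (nth x0 s k).
Proof.
move=> lt; case: (ltngtP (find a s) k) => [//|h|h] /=.
  by rewrite (before_find x0 h).
by rewrite -h nth_find // has_find h.
Qed.

Lemma find_ltS (T : Type) (x0 : T) a s k : k < size s ->
  (find a s < k.+1) = (find a s < k) || a (nth x0 s k).
Proof.
move=> lt; rewrite ltnS leq_eqVlt eq_sym (find_eqP x0 a lt).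
by case: (find a s < k) => //=; rewrite orbF.
Qed.

Lemma first_on_eq n e p : p < n ->
  (p == first_on n e) = ~~ (first_on n e < p) && on_track e p.
Proof. by move=> lt; rewrite (find_eqP 0) ?size_iota // nth_iota. Qed.

Lemma first_onS n e p : p < n ->
  (first_on n e < p.+1) = (first_on n e < p) || on_track e p.
Proof. by move=> lt; rewrite [LHS](find_ltS 0) ?size_iota // nth_iota. Qed.

Section Next.
Variable occ : pred L.

Definition nxt (lab : seq L) p := p.+1 + find occ (drop p.+1 lab).

Lemma nxt_eq lab x p : p < size lab ->
  (p == nxt lab x) = [&& x < p, ~~ (nxt lab x < p) & occ (nth l0 lab p)].
Proof.
rewrite /nxt => lt; case: ltnP => h /=; last by lia.
have -> : p = x.+1 + (p - x.+1) by lia.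
rewrite eqn_add2l ltn_add2l (find_eqP l0) ?size_drop; last by lia.
by rewrite nth_drop.
Qed.

Lemma nxtS lab x p : p < size lab ->
  (nxt lab x < p.+1) = (nxt lab x < p) || (x < p) && occ (nth l0 lab p).
Proof.
move=> lt; rewrite ltnS leq_eqVlt eq_sym nxt_eq //.
by case: (nxt _ _ < p); rewrite ?orbT ?orbF.
Qed.

Lemma defines_nxt d i : i < d -> d <= m ->
  defines d (fun lab s => Pos (nxt lab (pos_at (size lab) s i))).
Proof.
move=> lti led; exists (fupd d (fun _ : unit => (false, false))
  (fun q l f => ((q.1 || f (inord i), q.2 || q.1 && occ l), [&& q.1, ~~ q.2 & occ l]))
  (fun=> tt)), (fun n => 2 * n + 4); split; first by poly_tac.
move=> lab E; set x := pos_at _ _ _; exists (upd E d (Pos (nxt lab x))); split.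
- exact: agree_upd.
- by rewrite upd_eq.
have ex : x = first_on (size lab) (E i) by rewrite /x /pos_at at_mkseq.
apply: (runs_upd (fun p => (x < p, nxt lab x < p))) => // p ltp.
rewrite bit_cell; last by lia.
by rewrite /= nxt_eq // nxtS // ex first_onS.
Qed.
End Next.

Lemma defines_first d i : i < d -> d <= m ->
  defines d (fun lab s => Pos (pos_at (size lab) s i)).
Proof.
move=> lti led; exists (fupd d (fun _ : unit => false)
  (fun q l f => (q || f (inord i), ~~ q && f (inord i))) (fun=> tt)), (fun n => 2 * n + 4).
split; first by poly_tac.
move=> lab E; set x := pos_at _ _ _; exists (upd E d (Pos x)); split.
- exact: agree_upd.
- by rewrite upd_eq.
have ex : x = first_on (size lab) (E i) by rewrite /x /pos_at at_mkseq.
apply: (runs_upd (fun p => x < p)) => // p ltp.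
rewrite bit_cell; last by lia.
by rewrite /= ex first_onS // first_on_eq.
Qed.

Lemma defines_after_first d i : i < d -> d <= m ->
  defines d (fun lab s => Pos (pos_at (size lab) s i).+1).
Proof.
move=> lti led; exists (fupd d (fun _ : unit => (false, false))
  (fun q l f => ((q.1 || f (inord i), ~~ q.1 && f (inord i)), q.2))
  (fun=> tt)), (fun n => 2 * n + 4).
split; first by poly_tac.
move=> lab E; set x := pos_at _ _ _; exists (upd E d (Pos x.+1)); split.
- exact: agree_upd.
- by rewrite upd_eq.
have ex : x = first_on (size lab) (E i) by rewrite /x /pos_at at_mkseq.
apply: (runs_upd (fun p => (x < p, p == x.+1))) => // p ltp.
rewrite bit_cell; last by lia.
by rewrite /= eqSS ex first_onS // first_on_eq.
Qed.

(** * Comparing two encoded constants *)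

Section Compare.
Variable stop : L.

Fixpoint same_upto (u v : seq L) :=
  if (u, v) is (x :: u', y :: v') then
    (x == y) && ((x == stop) || same_upto u' v')
  else false.

Definition read (lab : seq L) x := if x < size lab then Some (nth l0 lab x) else None.

Definition shift_read (A : finType) B d (g : A -> option L -> B) : frag sym A B :=
  fupd d (fun a => (a, false, None))
    (fun q l t => ((q.1.1, t (inord d), if t (inord d) then Some l else q.2), q.1.2))
    (fun q => g q.1.1 q.2).

Lemma runs_shift_read (A : finType) B d (g : A -> option L -> B) lab E a x :
  d <= m -> E d = Pos x ->
  runs (shift_read d g) (a, wtape lab E) (2 * size lab + 4)
    (g a (read lab x), wtape lab (upd E d (Pos x.+1))).
Proof.
move=> led e.
apply: (runs_upd (fun p => (a, p == x.+1, if x < p then Some (nth l0 lab x) else None))) => //.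
move=> p ltp; rewrite bit_cell // e /= eqSS; congr (_, _, _, _).
by case: (ltngtP x p) => [h|h|->]; rewrite ?ltnSn //; case: ltnP => //; lia.
Qed.

Lemma same_upto_read lab x y :
  same_upto (drop x lab) (drop y lab) =
  match read lab x, read lab y with
  | Some a, Some b => (a == b) && ((a == stop) || same_upto (drop x.+1 lab) (drop y.+1 lab))
  | _, _ => false
  end.
Proof.
rewrite /read; case: ltnP => hx; last by rewrite (drop_oversize hx).
rewrite [drop x lab](drop_nth l0 hx).
case: ltnP => hy; last by rewrite (drop_oversize hy).
by rewrite [drop y lab](drop_nth l0 hy).
Qed.

(** Constants have unbounded length. Pebbles on tracks [d] and [d.+1] therefore advance in lockstep,
    one letter per round, while the loop counter on track [d.+2] limits the number of rounds. After
    a verdict the remaining rounds idle. *)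
Lemma dec_same d i j : i < d -> j < d -> d.+2 <= m ->
  dec d (fun lab s => same_upto (drop (pos_at (size lab) s i).+1 lab)
                                (drop (pos_at (size lab) s j).+1 lab)).
Proof.
move=> lti ltj led.
pose judge (a b : option L) : option bool :=
  if (a, b) is (Some x, Some y) then
    if x == y then if x == stop then Some true else None else Some false
  else Some false.
pose br (r : option bool) : bool + unit := if r is Some b then inl b else inr tt.
pose body := fseq (fret sym br) (fcase (fret sym Some)
  (fseq (shift_read d (fun (_ : unit) a => a)) (shift_read d.+1 judge))).
have [F1 [T1 [pT1 h1]]] := @defines_after_first d i lti ltac:(lia).
have [F2 [T2 [pT2 h2]]] := @defines_after_first d.+1 j ltac:(lia) ltac:(lia).
exists (fseq (fseq F1 F2) (fseq (fret sym (fun=> None))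
  (fseq (ffor d.+2 body) (fret sym (fun r => r == Some true))))).
pose TB n := 4 * n + 10.
exists (fun n => T1 n + T2 n + n.+2 * (TB n + 4 * n + 20) + 4); split.
  by poly_tac; apply: poly_for; rewrite /TB; poly_tac.
move=> lab E; have [E1 [ag1 e1 r1]] := h1 lab E; have [E2 [ag2 e2 r2]] := h2 lab E1.
set x := pos_at _ _ _ in e1 *; set y := pos_at _ _ _.
have ey : pos_at (size lab) (mkseq E1 d.+1) j = y.
  by rewrite /y /pos_at !at_mkseq ?ag1 //; lia.
rewrite ey in e2.
(* The register [None] means that the first [z] letters agree and none of them is [stop], so the
   answer is that of the remaining suffixes. The pebble positions matter only in this case. *)
pose I z (r : option bool) (E' : nat -> track) := [/\ agree d E E',
  r = None -> E' d = Pos (x.+1 + z) /\ E' d.+1 = Pos (y.+1 + z) &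
  same_upto (drop x.+1 lab) (drop y.+1 lab) =
  if r is Some b then b else same_upto (drop (x.+1 + z) lab) (drop (y.+1 + z) lab)].
have [||r [E' [run_ [ag e3 e4]]]] :=
  @runs_for _ d.+2 body I lab (TB (size lab)) led _ None E2.
- move=> z [b|] E3 ltz [ag3 pos3 eq3].
    exists (Some b), (upd E3 d.+2 (Pos z)); split; last 1 first.
    + by split=> //; apply: agree_upd => //; lia.
    + have := runs_seq (runs_ret br (Some b) (wtape lab (upd E3 d.+2 (Pos z))))
        (runs_casel (fseq (shift_read d (fun (_ : unit) a => a)) (shift_read d.+1 judge))
           (runs_ret Some b _)).
      by apply: runs_le; rewrite /TB; lia.
    + by rewrite upd_eq.
  have [//|pd pd1] := pos3.
  set X := x.+1 + z in pd eq3; set Y := y.+1 + z in pd1 eq3.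
  set E4 := upd (upd (upd E3 d.+2 (Pos z)) d (Pos X.+1)) d.+1 (Pos Y.+1).
  exists (judge (read lab X) (read lab Y)), E4; split.
  + have := runs_seq (runs_ret br None (wtape lab (upd E3 d.+2 (Pos z))))
      (runs_caser (fret sym Some)
        (runs_seq (@runs_shift_read _ _ d (fun (_ : unit) a => a) lab
                     (upd E3 d.+2 (Pos z)) tt X ltac:(lia) _)
           (@runs_shift_read _ _ d.+1 judge lab
              (upd (upd E3 d.+2 (Pos z)) d (Pos X.+1)) (read lab X) Y ltac:(lia) _))).
    move=> h; apply: runs_le (h _ _); first by rewrite /TB; lia.
    * by rewrite upd_lt //; lia.
    * by rewrite upd_gt // upd_lt.
  + by rewrite /E4 upd_gt // upd_gt ?upd_eq.
  + split.
    * by rewrite /E4; do 3!(apply: agree_upd; first lia).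
    * move=> _; rewrite /E4 upd_eq upd_lt // upd_eq /X /Y.
      by split; congr Pos; lia.
    * rewrite eq3 same_upto_read /judge.
      have -> : X.+1 = x.+1 + z.+1 by rewrite /X; lia.
      have -> : Y.+1 = y.+1 + z.+1 by rewrite /Y; lia.
      case: (read lab X) => // a; case: (read lab Y) => // b.
      by case: eqP => // _; case: eqP.
- split.
  + by apply: agree_trans ag1 _; apply: agree_le ag2.
  + by rewrite e2 !addn0; split=> //; rewrite ag2.
  + by rewrite !addn0.
exists (upd E' d.+2 (Pos (size lab))); split; first by apply: agree_upd => //; lia.
(* A comparison still open after [size lab] rounds has run off the word, which [same_upto] counts as
   failure. *)
have -> : same_upto (drop x.+1 lab) (drop y.+1 lab) = (r == Some true).
  rewrite e4; case: (r) => [[]|] //.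
  by rewrite drop_oversize //; lia.
have := runs_seq (runs_seq r1 r2) (runs_seq (runs_ret (fun=> None) tt _)
  (runs_seq run_ (runs_ret (fun r => r == Some true) r _))).
by apply: runs_le; lia.
Qed.
End Compare.

(** * Reachability as a definable set of positions *)

Lemma dec_reach_step d stp : d.+4 <= m.+1 ->
  dec d.+4 (fun lab s => stp lab (take d s) (pos_at (size lab) s d.+2)
                             (pos_at (size lab) s d.+3)) ->
  exists (F : frag sym unit unit) T, poly T /\
    forall lab E p q, p < size lab -> q < size lab ->
      E d.+2 = Pos p -> E d.+3 = Pos q -> exists E',
      [/\ agree d E E', [/\ E' d.+1 = E d.+1, E' d.+2 = Pos p & E' d.+3 = Pos q],
          runs F (tt, wtape lab E) (T (size lab)) (tt, wtape lab E') &
          forall r, on_track (E' d) r =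
            on_track (E d) r || [&& r == q, on_track (E d) p & stp lab (mkseq E d) p q]].
Proof.
move=> led dstp.
(* Track [d] holds the set being closed, [d.+1] the round, [d.+2] the pebble [p] and [d.+3] the
   pebble [q]. Membership of [p] in the set amounts to a common cell of the tracks [d] and
   [d.+2]. *)
have dX : dec d.+4 (fun lab s => has (fun p =>
    [&& on_track (at_ s d) p, on_track (at_ s d.+2) p & predT (nth l0 lab p)])
    (iota 0 (size lab))) by apply: dec_common => //; lia.
have [F [T [pT h]]] := dec_and dX dstp.
pose br (b : bool) : unit + unit := if b then inl tt else inr tt.
pose add := fupd d (fun _ : unit => tt)
  (fun q l f => (q, f (inord d) || f (inord d.+3))) (fun=> tt).
exists (fseq F (fseq (fret sym br) (fcase add (fret sym id)))).
exists (fun n => T n + 2 * n + 6); split; first by poly_tac.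
move=> lab E p q ltp ltq ep eq.
have [E1 [ag r1]] := h lab E.
have e0 : has (fun p => [&& on_track (at_ (mkseq E d.+4) d) p,
    on_track (at_ (mkseq E d.+4) d.+2) p & predT (nth l0 lab p)]) (iota 0 (size lab))
    = on_track (E d) p.
  apply/hasP/idP => [[r _]|Xp].
    by rewrite !at_mkseq ?ep //; try lia; case/and3P=> h1 /= /eqP <-.
  exists p; first by rewrite mem_iota.
  by rewrite !at_mkseq ?ep //; try lia; rewrite Xp /= eqxx.
have e1 : take d (mkseq E d.+4) = mkseq E d.
  by rewrite /mkseq -map_take take_iota; congr (map _ (iota 0 _)); lia.
rewrite e0 e1 /pos_at !at_mkseq ?ep ?eq ?first_on_pos // in r1; try lia.
case B : (on_track (E d) p && stp lab (mkseq E d) p q) r1 => r1.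
  exists (upd E1 d (Mark (fun r => on_track (E d) r || (r == q)))); split.
  - by apply: agree_upd => //; apply: agree_le ag; lia.
  - by split; rewrite upd_gt ?ag //; lia.
  - have r2 : runs add (tt, wtape lab E1) (2 * size lab + 4)
        (tt, wtape lab (upd E1 d (Mark (fun r => on_track (E d) r || (r == q))))).
      apply: (runs_upd (fun=> tt)) => // r _.
      by rewrite !bit_cell ?ag ?eq //; lia.
    have := runs_seq r1 (runs_seq (runs_ret br true _) (runs_casel (fret sym id) r2)).
    by apply: runs_le; lia.
  - by move=> r; rewrite upd_eq andbT.
exists E1; split.
- by apply: agree_le ag; lia.
- by split; rewrite ?ag //; lia.
- have := runs_seq r1 (runs_seq (runs_ret br false _) (runs_caser add (runs_ret id tt _))).
  by apply: runs_le; lia.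
- by move=> r; rewrite andbF orbF ag //; lia.
Qed.

Definition reach n (e : rel nat) x q :=
  [exists i : 'I_n, exists j : 'I_n,
     [&& i == x :> nat, j == q :> nat & connect [rel a b : 'I_n | e a b] i j]].

(** The bound on [size p] comes from shortening to a duplicate-free path; because of it [n] rounds
    of relaxation suffice in [defines_reach]. *)
Lemma reachP n e x q :
  reach n e x q <-> x < n /\ exists p, [/\ size p < n, all (gtn n) p, path e x p & last x p = q].
Proof.
split=> [/existsP[i /existsP[j /and3P[/eqP <- /eqP <- /connectP[p pth ->]]]]|].
  split=> //; case/shortenP: pth => p' pth' uq _.
  exists (map val p'); split.
  - rewrite size_map; have := max_card (mem (i :: p')).
    by rewrite (card_uniqP uq) card_ord.
  - by apply/allP => y /mapP[z _ ->] /=.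
  - by rewrite path_map.
  - by rewrite last_map.
move=> [ltx [p [_ alp pth <-]]].
elim: p x ltx alp pth => [|y p IH] x ltx /=.
  by move=> _ _; apply/existsP; exists (Ordinal ltx); apply/existsP; exists (Ordinal ltx);
    rewrite /= !eqxx connect0.
move=> /andP[lty alp] /andP[xy pth].
have /existsP[i /existsP[j /and3P[/eqP ei /eqP ej cij]]] := IH y lty alp pth.
apply/existsP; exists (Ordinal ltx); apply/existsP; exists j; rewrite /= eqxx ej eqxx /=.
by apply: connect_trans cij; apply: connect1; rewrite /= ei.
Qed.

Lemma reachS n e x p q : reach n e x p -> q < n -> e p q -> reach n e x q.
Proof.
move=> /existsP[i /existsP[j /and3P[ei /eqP ej cij]]] ltq pq.
apply/existsP; exists i; apply/existsP; exists (Ordinal ltq); rewrite ei eqxx /=.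
by apply: connect_trans cij _; apply: connect1; rewrite /= ej.
Qed.

Lemma reach_path n e x p : x < n -> all (gtn n) p -> path e x p -> reach n e x (last x p).
Proof.
move=> ltx; elim/last_ind: p => [_ _|p y IH].
  by apply/reachP; split=> //; exists [::]; split=> //=; apply: leq_ltn_trans ltx.
rewrite all_rcons rcons_path last_rcons => /andP[lty al] /andP[pth ly].
exact: reachS (IH al pth) lty ly.
Qed.

Lemma eq_reach n e e' x q : e =2 e' -> reach n e x q = reach n e' x q.
Proof.
move=> eq; apply: eq_existsb => i; apply: eq_existsb => j; congr [&& _, _ & _].
by apply: eq_connect => a b /=.
Qed.

Lemma reach_lt n e x q : reach n e x q -> q < n.
Proof. by move=> /existsP[i /existsP[j /and3P[_ /eqP <- _]]]. Qed.

Lemma defines_reach d i stp : i < d -> d.+3 <= m ->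
  dec d.+4 (fun lab s => stp lab (take d s) (pos_at (size lab) s d.+2)
                             (pos_at (size lab) s d.+3)) ->
  defines d (fun lab s =>
    Mark (reach (size lab) (stp lab s) (pos_at (size lab) s i))).
Proof.
move=> lti led dstp.
have [F [T [pT h]]] := dec_reach_step led dstp.
have [F0 [T0 [pT0 h0]]] := @defines_first d i lti ltac:(lia).
exists (fseq F0 (ffor d.+1 (ffor d.+2 (ffor d.+3 F)))).
pose R (S : nat -> nat) n := n.+2 * (S n + 4 * n + 20).
exists (fun n => T0 n + R (R (R T)) n + 1); split.
  by poly_tac; do 3!apply: poly_for.
move=> lab E; set n := size lab; have [E0 [ag0 e0 r0]] := h0 lab E.
set e := stp _ _; set x := pos_at _ _ _ in e0 *.
(* Within a round the set may already contain positions farther away than the round number allows.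
   The invariants therefore keep only two inclusions: the set contains everything that is near
   enough, and everything in it is reachable. *)
pose near r a := x < n /\ exists p, [/\ size p <= r, all (gtn n) p, path e x p & last x p = a].
pose sound E1 := forall q, q < n -> on_track (E1 d) q -> reach n e x q.
pose base r E1 := [/\ agree d E E1, sound E1 & forall a, near r a -> on_track (E1 d) a].
pose done_ r p E1 := forall a b, a < p -> b < n -> near r a -> e a b -> on_track (E1 d) b.
pose I1 z (_ : unit) E1 := base z E1.
pose I2 z p (_ : unit) E1 := [/\ base z E1, done_ z p E1 & E1 d.+1 = Pos z].
pose I3 z p q (_ : unit) E1 := [/\ base z E1, done_ z p E1, E1 d.+1 = Pos z, E1 d.+2 = Pos p
  & forall b, b < q -> near z p -> e p b -> on_track (E1 d) b].
have base_upd z k X E1 : d < k -> base z E1 -> base z (upd E1 k X).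
  move=> ltk [ag so ne]; split; first by apply: agree_upd => //; lia.
  - by move=> q; rewrite upd_lt //; apply: so.
  - by move=> a; rewrite upd_lt //; apply: ne.
have [||[] [E' [run1 [ag so ne]]]] :=
  @runs_for _ d.+1 (ffor d.+2 (ffor d.+3 F)) I1 lab (R (R T) n) ltac:(lia) _ tt E0.
- move=> z [] E1 ltz b1.
  have [||[] [E2 [run2 [b2 dn2 z2]]]] :=
    @runs_for _ d.+2 (ffor d.+3 F) (I2 z) lab (R T n) ltac:(lia) _ tt (upd E1 d.+1 (Pos z)).
  + move=> p [] E2 ltp [b2 dn2 z2].
    have [||[] [E3 [run3 [b3 dn3 z3 p3 rw3]]]] :=
      @runs_for _ d.+3 F (I3 z p) lab (T n) ltac:(lia) _ tt (upd E2 d.+2 (Pos p)).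
    * move=> q [] E3 ltq [b3 dn3 z3 p3 rw3].
      have [|E4 [ag4 [z4 p4 q4] run4 eq4]] :=
        h lab (upd E3 d.+3 (Pos q)) p q ltp ltq _ (upd_eq _ _ _).
        by rewrite upd_lt.
      case: b3 => ag3 so3 ne3.
      have ag5 : agree d E (upd E3 d.+3 (Pos q)) by apply: agree_upd => //; lia.
      rewrite (agree_mkseq ag5) -/e upd_lt in eq4; last by lia.
      exists tt, E4; split=> //; split.
      - split; first exact: agree_trans ag4.
        + move=> r ltr; rewrite eq4 => /orP[/so3->//|/and3P[/eqP e' Xp pq]]; rewrite -e' in pq.
          exact: reachS (so3 _ ltp Xp) ltr pq.
        + by move=> a /ne3; rewrite eq4 => ->.
      - by move=> a b lta ltb na ab; rewrite eq4 (dn3 a b).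
      - by rewrite z4 upd_lt.
      - by [].
      - move=> b; rewrite ltnS leq_eqVlt => /orP[/eqP -> np pb|ltb np pb].
          by rewrite eq4 eqxx (ne3 p) // pb orbT.
        by rewrite eq4 rw3.
    * split=> //; first exact: base_upd.
      - by move=> a b lta ltb na ab; rewrite upd_lt // (dn2 a b).
      - by rewrite upd_lt.
      - by rewrite upd_eq.
    exists tt, (upd E3 d.+3 (Pos n)); split=> //; first by rewrite upd_lt.
    split; first by apply: base_upd => //; lia.
    * move=> a b; rewrite ltnS leq_eqVlt upd_lt; last by lia.
      by move=> /orP[/eqP ->|lta] ltb na ab; [apply: rw3 | apply: (dn3 a b)].
    * by rewrite upd_lt.
  + by split=> //; [apply: base_upd | rewrite upd_eq].
  exists tt, (upd E2 d.+2 (Pos n)); split=> //; first by rewrite upd_lt.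
  case: b2 => ag2 so2 ne2; split; first by apply: agree_upd => //; lia.
  + by move=> q ltq; rewrite upd_lt //; apply: so2.
  + move=> a [ltx [p [szp alp pth la]]]; rewrite upd_lt //.
    elim/last_ind: p szp alp pth la => [|p b _] szp alp pth la.
      by apply: ne2; split=> //; exists [::].
    move: szp alp pth la; rewrite size_rcons all_rcons rcons_path last_rcons /=.
    move=> szp /andP[ltb alp] /andP[pth lb] <-.
    apply: (dn2 (last x p) b) => //.
      case/lastP: (p) alp => [//|p' c]; by rewrite all_rcons last_rcons => /andP[].
    by split=> //; exists p.
- split=> //.
  + move=> q ltq; rewrite e0 /= => /eqP eq; rewrite -eq; apply/reachP.
    by split; [ | exists [::]; split=> //=; lia].
  + by move=> a [_ [[|? ?] [// _ _ _ <-]]]; rewrite e0 /=.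
set E'' := upd E' d.+1 _ in run1.
exists (upd E'' d (Mark (reach n e x))); split; last 1 first.
(* The computed set and [reach] agree on all cells of the word, so both environments describe the
   same tape. *)
- have -> : wtape lab (upd E'' d (Mark (reach n e x))) = wtape lab E''.
    congr tape_of; apply: word_ext => j q ltq; rewrite {1}/upd.
    case: eqP => // ->; rewrite /E'' upd_lt //=; apply/idP/idP; last exact: so.
    move=> /reachP[ltx [p [szp alp pth la]]]; apply: ne; split=> //.
    by exists p; split=> //; apply: ltnW.
  have := runs_seq r0 run1; apply: runs_le.
  by rewrite -/n -/(R _ n) addn1.
- by do 2!apply: agree_upd => //.
- by rewrite upd_eq.
Qed.
End Tracks.

(** * The formula *)

Section DecDerived.
Variables (L : finType) (l0 : L) (m : nat).
Implicit Types (lab : seq L) (s : seq track).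

Local Notation pos lab s i := (pos_at (size lab) s i).

Lemma pos_rcons_lt lab s e i : i < size s -> pos lab (rcons s e) i = pos lab s i.
Proof. by rewrite /pos_at /at_ nth_rcons => ->. Qed.

Lemma at_rcons s e : at_ (rcons s e) (size s) = e.
Proof. by rewrite /at_ nth_rcons ltnn eqxx. Qed.

Lemma pos_rcons lab s p : pos lab (rcons s (Pos p)) (size s) = minn p (size lab).
Proof. by rewrite /pos_at at_rcons first_on_posP. Qed.

Lemma pos_rcons_in lab s (p : nat) : p < size lab ->
  pos lab (rcons s (Pos p)) (size s) = p.
Proof. by rewrite pos_rcons => /ltnW/minn_idPl. Qed.

Lemma on_track_pos lab s i : pos lab s i < size lab ->
  on_track (at_ s i) (pos lab s i).
Proof.
rewrite /pos_at /first_on => lt.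
have h : has (on_track (at_ s i)) (iota 0 (size lab)) by rewrite has_find size_iota.
by have := nth_find 0 h; rewrite nth_iota.
Qed.

Lemma dec_at d i j P : i < d -> j < d -> d <= m ->
  dec l0 m d (fun lab s => [&& pos lab s i < size lab,
     on_track (at_ s j) (pos lab s i) & P (nth l0 lab (pos lab s i))]).
Proof.
move=> lti ltj led.
have := dec_let (defines_first l0 lti led) (@dec_common _ l0 m d.+1 d j P ltac:(lia) ltac:(lia) ltac:(lia)).
apply: dec_ext => lab s szs.
rewrite -szs at_rcons; set x := pos lab s i.
have -> : at_ (rcons s (Pos x)) j = at_ s j by rewrite /at_ nth_rcons szs ltj.
apply/hasP/and3P => [[p]|[ltx h1 h2]].
  by rewrite mem_iota /= => ltp /and3P[/eqP<- ? ?].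
by exists x; rewrite ?mem_iota //= eqxx h1.
Qed.

Lemma dec_label d i P : i < d -> d <= m ->
  dec l0 m d (fun lab s => (pos lab s i < size lab) && P (nth l0 lab (pos lab s i))).
Proof.
move=> lti led; apply: dec_ext (dec_at P lti lti led) => lab s szs.
by case: ltnP => //= lt; rewrite on_track_pos.
Qed.

Lemma dec_mem d i j : i < d -> j < d -> d <= m ->
  dec l0 m d (fun lab s => (pos lab s i < size lab) && on_track (at_ s j) (pos lab s i)).
Proof.
move=> lti ltj led; apply: dec_ext (dec_at predT lti ltj led) => lab s szs.
by rewrite andbT.
Qed.

(** A pebble beyond the end is read back as [size lab]. For a formula that looks only at the suffix
    behind the position this makes no difference, as both suffixes are empty. *)
Lemma drop_minn lab p : drop (minn p (size lab)).+1 lab = drop p.+1 lab.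
Proof.
case: (ltnP p (size lab)) => h //.
by rewrite !drop_oversize //; lia.
Qed.

End DecDerived.

Section Query.
Variable k : nat.
Hypothesis k2 : 2 <= k.

(* Labels of the cells of a parsed database: [None] ends a number, [inr (R, b)]
   starts an argument of a fact whose relation name has binary digits R, b
   telling whether it is the first argument; other cells keep their bit. *)
Definition label : finType := option (bool + (k.-bseq bool * bool)).

Definition starts_arg (l : label) := if l is Some (inr _) then true else false.
Definition rname i : k.-bseq bool := insub_bseq k (bits i).

Implicit Types (lab : seq label) (s : seq track).
Local Notation pos lab s i := (pos_at (size lab) s i).

(** A fact is represented by the cell that opens its first argument; this cell also carries the
    relation name. *)
Definition is_rel i lab p :=
  (p < size lab) && (nth None lab p == Some (inr (rname i, true)) :> label).
Definition same_arg lab p q := same_upto None (drop p.+1 lab) (drop q.+1 lab).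
Definition next_arg lab p := nxt starts_arg lab p.
Definition linkp lab p q :=
  has (fun i => is_rel i lab p && is_rel (i %% k).+1 lab q) (iota 1 k)
  && same_arg lab (next_arg lab p) q.
Definition keqp lab p q :=
  has (fun i => is_rel i lab p && is_rel i lab q) (iota 1 k) && same_arg lab p q.
Fixpoint args_match lab p us :=
  if us is u :: us' then same_arg lab p u && args_match lab (next_arg lab p) us'
  else true.
Definition Sp lab us :=
  has (fun p => is_rel 0 lab p && args_match lab p us) (iota 0 (size lab)).

Fixpoint path_formula j (phi : seq label -> seq track -> bool) lab s :=
  if j is j'.+1 then
    has (fun p => linkp lab (pos lab s (size s).-1) p && path_formula j' phi lab (rcons s (Pos p)))
      (iota 0 (size lab))
  else phi lab s.

(** Level [a] holds the first fact of the path and the levels [a.+1] to [a + k.-1] the facts that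
    continue it. Key-equality is equality of source vertices, so this is one step of a return
    path. *)
Definition avoidp lab s a p q :=
  linkp lab p q && all (fun i => ~~ keqp lab q (pos lab s i)) (iota a.+1 k.-1).
Definition return_formula a lab s :=
  has (fun h => reach (size lab) (avoidp lab s a) (pos lab s (a + k.-1)) h
                && linkp lab h (pos lab s a)) (iota 0 (size lab)).
Definition cycle_formula a lab s :=
  ~~ (linkp lab (pos lab s (a + k.-1)) (pos lab s a)
      && Sp lab [seq pos lab s i | i <- iota a k])
  && return_formula a lab s.

(** The context has [f] at level 0, the set reachable from [f] at level 1 and [g] at level 2, whence
    [cycle_formula 2]. On the tape, membership in the stored set replaces the call to [reach]. *)
Definition lostp lab f g :=
  reach (size lab) (linkp lab) f g &&
  ~~ (has (linkp lab g) (iota 0 (size lab)) &&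
      ~~ (is_rel 1 lab g &&
          path_formula k.-1 (cycle_formula 2) lab
            [:: Pos f; Mark (reach (size lab) (linkp lab) f); Pos g])).
Definition certain_formula lab (s : seq track) :=
  has (fun f => has (fun i => is_rel i lab f) (iota 1 k)
                && ~~ has (lostp lab f) (iota 0 (size lab))) (iota 0 (size lab)).

Variable m : nat.
Local Notation dec := (@dec label None m).

Lemma dec_is_rel d r i : i < d -> d <= m -> dec d (fun lab s => is_rel r lab (pos lab s i)).
Proof. by move=> lti led; apply: dec_label. Qed.

Lemma dec_same_arg d i j : i < d -> j < d -> d.+2 <= m ->
  dec d (fun lab s => same_arg lab (pos lab s i) (pos lab s j)).
Proof. exact: dec_same. Qed.

Lemma same_arg_minn lab p q : same_arg lab (minn p (size lab)) q = same_arg lab p q.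
Proof. by rewrite /same_arg drop_minn. Qed.

Lemma dec_link d i j : i < d -> j < d -> d.+3 <= m ->
  dec d (fun lab s => linkp lab (pos lab s i) (pos lab s j)).
Proof.
move=> lti ltj led; apply: dec_and.
  by apply: dec_has => r _; apply: dec_and; apply: dec_is_rel => //; lia.
have := dec_let (@defines_nxt _ None m starts_arg d i lti ltac:(lia))
  (@dec_same_arg d.+1 d j ltac:(lia) ltac:(lia) ltac:(lia)).
by apply: dec_ext => lab s szs; rewrite -szs pos_rcons same_arg_minn pos_rcons_lt ?szs.
Qed.

Lemma dec_keq d i j : i < d -> j < d -> d.+2 <= m ->
  dec d (fun lab s => keqp lab (pos lab s i) (pos lab s j)).
Proof.
move=> lti ltj led; apply: dec_and; last exact: dec_same_arg.
by apply: dec_has => r _; apply: dec_and; apply: dec_is_rel => //; lia.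
Qed.

Lemma args_match_ge lab p us : size lab <= p -> args_match lab p us = nilp us.
Proof. by case: us => //= u us h; rewrite /same_arg drop_oversize // ltnW. Qed.

Lemma args_match_minn lab p us :
  args_match lab (minn p (size lab)) us = args_match lab p us.
Proof.
case: (ltnP p (size lab)) => h //.
by rewrite !args_match_ge //; lia.
Qed.

Lemma dec_args_match d l : 0 < d -> all (gtn d) l -> d + size l + 2 <= m ->
  dec d (fun lab s => args_match lab (pos lab s d.-1) [seq pos lab s i | i <- l]).
Proof.
elim: l d => [|i l IH] d d0 /=; first by move=> *; apply: dec_const.
move=> /andP[lti all_l] led; apply: dec_and; first by apply: dec_same_arg; lia.
have hl : all (gtn d.+1) l by apply: sub_all all_l => x /=; lia.
have := dec_let (@defines_nxt _ None m starts_arg d d.-1 ltac:(lia) ltac:(lia))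
  (IH d.+1 isT hl ltac:(lia)).
apply: dec_ext => lab s szs; rewrite -szs pos_rcons args_match_minn.
congr (args_match _ _ _); apply/eq_in_map => x xl.
by rewrite pos_rcons_lt // szs; apply: (allP all_l).
Qed.

Lemma dec_ex_pos d phi : d <= m ->
  dec d.+1 (fun lab s => phi lab (take d s) (pos lab s d)) ->
  dec d (fun lab s => has (phi lab s) (iota 0 (size lab))).
Proof.
move=> led h; have := dec_ex led h.
apply: dec_ext => lab s szs; apply: eq_in_has => p; rewrite mem_iota /= => ltp.
by rewrite -szs pos_rcons_in // -cats1 take_size_cat.
Qed.

Lemma pos_take lab s d i : i < d -> pos lab (take d s) i = pos lab s i.
Proof. by move=> lt; rewrite /pos_at /at_ nth_take. Qed.

Lemma dec_Sp d l : all (gtn d) l -> d + size l + 3 <= m ->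
  dec d (fun lab s => Sp lab [seq pos lab s i | i <- l]).
Proof.
move=> all_l led.
apply: (@dec_ex_pos d (fun lab s p => is_rel 0 lab p && args_match lab p [seq pos lab s i | i <- l])); first by lia.
apply: dec_and; first by apply: dec_is_rel; lia.
have hl : all (gtn d.+1) l by apply: sub_all all_l => x /=; lia.
apply: dec_ext (@dec_args_match d.+1 l isT hl ltac:(lia)) => lab s szs.
congr (args_match _ _ _); apply/eq_in_map => x xl.
by rewrite pos_take //; apply: (allP all_l).
Qed.

Lemma dec_path_formula j d phi : 0 < d -> d + j + 3 <= m -> dec (d + j) phi ->
  dec d (path_formula j phi).
Proof.
elim: j d => [|j IH] d d0 led h; first by rewrite addn0 in h.
have h' : dec d.+1 (fun lab s => linkp lab (pos lab s d.-1) (pos lab s d) && path_formula j phi lab s).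
  apply: dec_and; first by apply: dec_link; lia.
  by apply: IH; rewrite ?addSnnS //; lia.
apply: dec_ext (dec_ex _ h'); last by lia.
move=> lab s szs; apply: eq_in_has => p; rewrite mem_iota /= => ltp.
by rewrite -szs pos_rcons_in // pos_rcons_lt // ltn_predL szs.
Qed.

Lemma dec_return_formula a d : a + k.-1 < d -> d + 10 <= m -> dec d (return_formula a).
Proof.
move=> led ledm.
have st : dec d.+4 (fun lab s => avoidp lab (take d s) a (pos lab s d.+2) (pos lab s d.+3)).
  apply: dec_and; first by apply: dec_link; lia.
  apply: dec_all => i; rewrite mem_iota => hi; apply: dec_not.
  apply: dec_ext (@dec_keq d.+4 d.+3 i ltac:(lia) ltac:(lia) ltac:(lia)) => lab s szs.
  by rewrite pos_take //; lia.
have df := @defines_reach _ None m d (a + k.-1) (fun lab s => avoidp lab s a) led ltac:(lia) st.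
have h : dec d.+2 (fun lab s => (pos lab s d.+1 < size lab) && on_track (at_ s d) (pos lab s d.+1)
    && linkp lab (pos lab s d.+1) (pos lab s a)).
  by apply: dec_and; [apply: dec_mem | apply: dec_link]; lia.
apply: dec_ext (dec_let df (dec_ex _ h)); last by lia.
move=> lab s szs; apply: eq_in_has => p; rewrite mem_iota /= => ltp.
have sz1 x : size (rcons s x) = d.+1 by rewrite size_rcons szs.
rewrite -{1 2 3}(sz1 (Mark (reach (size lab) (avoidp lab s a) (pos lab s (a + k.-1))))).
rewrite pos_rcons_in // ltp /=.
rewrite !pos_rcons_lt ?sz1; try lia.
by rewrite {1}/at_ nth_rcons sz1 ltnSn -szs -/(at_ _ _) at_rcons.
Qed.

Lemma dec_cycle_formula a : a + 2 * k + 20 <= m -> dec (a + k) (cycle_formula a).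
Proof.
move=> led; apply: dec_and; last by apply: dec_return_formula; lia.
apply: dec_not; apply: dec_and; first by apply: dec_link; lia.
by apply: dec_Sp; [apply/allP => i; rewrite mem_iota /=; lia | rewrite size_iota; lia].
Qed.

(** A generous supply of tracks: [k] pebbles for the path, [k] for walking along the arguments of an
    [S_k]-fact, and constantly many for sets, counters and comparisons. *)
Lemma dec_certain_formula : 3 * k + 40 <= m -> dec 0 certain_formula.
Proof.
move=> led.
pose phi lab s := has (fun i => is_rel i lab (pos lab s 0)) (iota 1 k) &&
  ~~ has (fun g => ((pos lab (rcons s (Pos g)) 2 < size lab) &&
                    on_track (at_ (rcons s (Pos g)) 1) (pos lab (rcons s (Pos g)) 2)) &&
     ~~ (has (fun h => linkp lab (pos lab (rcons (rcons s (Pos g)) (Pos h)) 2)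
                                 (pos lab (rcons (rcons s (Pos g)) (Pos h)) 3)) (iota 0 (size lab)) &&
         ~~ (is_rel 1 lab (pos lab (rcons s (Pos g)) 2) &&
             path_formula k.-1 (cycle_formula 2) lab (rcons s (Pos g))))) (iota 0 (size lab)).
have dphi : dec 2 phi.
  apply: dec_and; first by apply: dec_has => i _; apply: dec_is_rel; lia.
  apply: dec_not; apply: (@dec_ex _ None m 2 (fun lab s =>
     (pos lab s 2 < size lab) && on_track (at_ s 1) (pos lab s 2) &&
     ~~ (has (fun h => linkp lab (pos lab (rcons s (Pos h)) 2) (pos lab (rcons s (Pos h)) 3))
             (iota 0 (size lab)) &&
         ~~ (is_rel 1 lab (pos lab s 2) && path_formula k.-1 (cycle_formula 2) lab s)))); first by lia.
  apply: dec_and; first by apply: dec_mem; lia.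
  apply: dec_not; apply: dec_and.
    by apply: (@dec_ex _ None m 3 (fun lab s => linkp lab (pos lab s 2) (pos lab s 3)));
      [lia | apply: dec_link; lia].
  apply: dec_not; apply: dec_and; first by apply: dec_is_rel; lia.
  apply: dec_path_formula => //; first by lia.
  have -> : 3 + k.-1 = 2 + k by lia.
  by apply: dec_cycle_formula; lia.
have dl : dec 5 (fun lab s => linkp lab (pos lab s 3) (pos lab s 4)) by apply: dec_link; lia.
have df := @defines_reach _ None m 1 0 (fun lab s => linkp lab) isT ltac:(lia) dl.
apply: dec_ext (dec_ex _ (dec_let df dphi)); last by [].
move=> lab s /size0nil -> /=; apply: eq_in_has => f; rewrite mem_iota /= => ltf.
rewrite /phi /=; set X := Mark _.
have e0 t : pos lab [:: Pos f & t] 0 = f by rewrite /pos_at first_on_pos.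
rewrite {1}/pos_at /at_ /= first_on_pos //; congr (_ && ~~ _).
apply: eq_in_has => g; rewrite mem_iota /= => ltg.
have e2 Y t : pos lab [:: Pos f, Y, Pos g & t] 2 = g by rewrite /pos_at first_on_pos.
rewrite /lostp !e2 ltg /= /X [pos_at _ _ 0]e0; congr (_ && ~~ (_ && _)).
apply: eq_in_has => h; rewrite mem_iota /= => lth.
by rewrite e2 /pos_at /at_ /= first_on_pos.
Qed.
End Query.

(** * Parsing the input *)

(** A crude bound, but enough to fit the digits of a relation name [R <= k] into a [k.-bseq]. *)
Lemma size_bits n : size (bits n) <= n.
Proof.
rewrite /bits; move: {2}n => m; elim: n m => [|n IH] [|m] //=.
by rewrite ltnS; apply: IH.
Qed.

Lemma bits_inj : injective bits.
Proof.
pose value := foldr (fun (b : bool) v => b + v.*2) 0.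
suff h fuel n : n <= fuel -> value (bits_aux fuel n) = n.
  by move=> n n' eq; rewrite -(h n n) // -/(bits n) eq h.
elim: fuel n => [|fuel IH] [|n] //= le.
rewrite -/(value _) IH; first exact: (odd_double_half n.+1).
rewrite -[X in X <= _]/(n.+1./2); have := odd_double_half n.+1; rewrite -addnn.
by move: (n.+1./2) => h; case: (odd _); lia.
Qed.

Lemma scan_cat (G : finType) Q (f : Q -> G -> Q * G) q q1 q2 u u' v v' :
  scan f q u = (q1, u') -> scan f q1 v = (q2, v') ->
  scan f q (u ++ v) = (q2, u' ++ v').
Proof.
elim: u q u' => [|x u IH] q u' /=; first by case=> -> <- ->.
case: (f q x) => q3 y; case E: (scan f q3 u) => [q4 u2] [eq <-] sv.
by rewrite (IH q3 u2) // -eq.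
Qed.
Arguments scan_cat {G Q f q q1 q2 u u' v v'}.

Section Parse.
Variable k : nat.
Hypothesis k2 : 2 <= k.
Local Notation label := (label k).
Local Notation rname := (rname k).

Definition raw (b : bool) : label := Some (inl b).

(* What the next bit means: [AtDb] begin a fact or stop, [AtFact] begin a number
   or stop, [AtNat] begin a digit or stop, [AtBit] a digit. *)
Definition AtDb := (false, false).
Definition AtFact := (true, false).
Definition AtNat := (true, true).
Definition AtBit := (false, true).

(* Besides the mode, a state holds the role of the current number (relation
   name, first argument, later argument) and the digits of the relation name. *)
Definition pstate := (bool * bool * option bool * k.-bseq bool)%type.

(** The parse is done in place, one cell per bit: the bit that announces an argument becomes its
    marker, and the bit that closes a number becomes [None]. *)
Definition pstep (q : pstate) (l : label) : pstate * label :=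
  let b := l == raw true in
  let: (md, role, r) := q in
  match md with
  | (false, false) => if b then ((AtFact, None, insub_bseq k [::]), raw true)
                      else (q, raw false)
  | (true, false) => if b then ((AtNat, role, r),
                        if role is Some first then Some (inr (r, first)) else raw true)
                     else ((AtDb, role, r), raw false)
  | (true, true) => if b then ((AtBit, role, r), raw true)
                    else ((AtFact, Some (role == None), r), None)
  | (false, true) => ((AtNat, role,
                       if role is None then insub_bseq k (rcons r b) else r), raw b)
  end.

Definition digits n := flatten [seq [:: true; b] | b <- bits n].
Definition wnat n : seq label := map raw (digits n) ++ [:: None].
Fixpoint wargs r first (l : seq nat) : seq label :=
  if l is a :: l' then Some (inr (r, first)) :: wnat a ++ wargs r false l' else [::].
Definition whead n : seq label := raw true :: raw true :: wnat n.
Definition wfact (f : fact) : seq label :=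
  whead f.1 ++ wargs (rname f.1) true f.2 ++ [:: raw false].
Definition wdb (db : seq fact) := flatten (map wfact db) ++ [:: raw false].

Lemma enc_natE n : enc_nat n = digits n ++ [:: false].
Proof. by []. Qed.

Lemma val_insub_bseq (s : seq bool) : size s <= k -> insub_bseq k s = s :> seq bool.
Proof. by move=> h; rewrite /insub_bseq /insubd insubT. Qed.

Lemma pstep_digits role (r : k.-bseq bool) (bs : seq bool) :
  (role = None -> size r + size bs <= k) ->
  scan pstep (AtNat, role, r) (map raw (flatten [seq [:: true; b] | b <- bs])) =
  ((AtNat, role, if role is None then insub_bseq k (r ++ bs) else r),
   map raw (flatten [seq [:: true; b] | b <- bs])).
Proof.
elim: bs r => [|b bs IH] r le /=.
  by case: role {le} => //; rewrite cats0 /insub_bseq (valKd [bseq]).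
have eb : (raw b == raw true) = b by case: (b).
rewrite eb IH; last first.
  move=> eq; rewrite eq; have := le eq => /= {}le.
  by rewrite val_insub_bseq size_rcons; lia.
case: role le {IH} => [c|] //= le; congr (_, _, _, _).
have h : size (rcons r b) <= k by rewrite size_rcons; have := le erefl; lia.
by rewrite val_insub_bseq // cat_rcons.
Qed.

Lemma pstep_nat role (r : k.-bseq bool) n :
  (role = None -> r = insub_bseq k [::] /\ n <= k) ->
  scan pstep (AtNat, role, r) (map raw (enc_nat n)) =
  ((AtFact, Some (role == None), if role is None then rname n else r), wnat n).
Proof.
move=> h; rewrite enc_natE map_cat; apply: scan_cat.
  apply: pstep_digits => /h[-> le].
  by rewrite val_insub_bseq // (leq_trans (size_bits n)).
case: role h => [c|] h //=; have [-> _] := h erefl.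
by rewrite val_insub_bseq.
Qed.

Lemma pstep_args first (r : k.-bseq bool) l :
  exists role, scan pstep (AtFact, Some first, r)
    (map raw (flatten [seq true :: enc_nat x | x <- l])) =
    ((AtFact, role, r), wargs r first l).
Proof.
elim: l first => [|a l IH] first /=; first by exists (Some first).
have [role e] := IH false; exists role.
rewrite -cat_cons -/(wnat a); change (scan pstep (AtFact, Some first, r)
  (map raw ([:: true] ++ enc_nat a ++ flatten [seq true :: enc_nat x | x <- l])) =
  (AtFact, role, r, [:: Some (inr (r, first))] ++ wnat a ++ wargs r false l)).
rewrite (map_cat raw [:: true]) (map_cat raw (enc_nat a)); apply: scan_cat; first by [].
by apply: scan_cat e; apply: (@pstep_nat (Some first) r a).
Qed.

Lemma pstep_fact f role (r : k.-bseq bool) : f.1 <= k ->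
  exists role' r', scan pstep (AtDb, role, r) (map raw (true :: enc_fact f)) =
    ((AtDb, role', r'), wfact f).
Proof.
move=> le; have [role' e] := pstep_args true (rname f.1) f.2.
exists role', (rname f.1).
have -> : true :: enc_fact f = [:: true; true] ++ enc_nat f.1 ++
    flatten [seq true :: enc_nat x | x <- f.2] ++ [:: false] by rewrite /enc_fact /enc_list /= -catA.
have -> : wfact f = [:: raw true; raw true] ++ wnat f.1 ++
    wargs (rname f.1) true f.2 ++ [:: raw false] by [].
rewrite (map_cat raw [:: true; true]) (map_cat raw (enc_nat f.1)) (map_cat raw (flatten _)).
apply: scan_cat; first by [].
apply: scan_cat (scan_cat e _); last by [].
exact: (@pstep_nat None (insub_bseq k [::]) f.1).
Qed.

Lemma pstep_db db role (r : k.-bseq bool) : (forall f, f \in db -> f.1 <= k) ->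
  exists q, scan pstep (AtDb, role, r) (map raw (enc_db db)) = (q, wdb db).
Proof.
rewrite /enc_db /enc_list /wdb; elim: db role r => [|f db IH] role r h.
  by exists (AtDb, role, r).
have [|role1 [r1 e1]] := @pstep_fact f role r; first by apply: h; rewrite mem_head.
have [|q e] := IH role1 r1; first by move=> g gdb; apply: h; rewrite inE gdb orbT.
exists q; rewrite -[flatten (map _ (f :: db))]/((true :: enc_fact f) ++ _) -catA.
rewrite (map_cat raw (true :: enc_fact f)) -[flatten (map _ (f :: db))]/(_ ++ _) -catA.
exact: scan_cat e1 e.
Qed.

Definition is_first (l : label) := if l is Some (inr (_, true)) then true else false.

Lemma all_raw (P : pred label) bs : (forall b, P (raw b)) -> all P (map raw bs).
Proof. by move=> h; apply/allP => x /mapP[b _ ->]. Qed.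

Lemma wnat_no_arg n : all (predC (@starts_arg k)) (wnat n).
Proof. by rewrite all_cat /= andbT all_raw. Qed.

Lemma wnat_not_first n : all (predC is_first) (wnat n).
Proof.
by apply/allP => l /(allP (wnat_no_arg n)); case: l => [[b|[r c]]|].
Qed.

Lemma wargs_not_first r l : all (predC is_first) (wargs r false l).
Proof.
elim: l => //= a l IH; by rewrite all_cat IH andbT wnat_not_first.
Qed.

Definition holds_at (lab : seq label) p (f : fact) :=
  prefix (wargs (rname f.1) true f.2 ++ [:: raw false]) (drop p lab).

Lemma wdb_cons f db : wdb (f :: db) = wfact f ++ wdb db.
Proof. by rewrite {1}/wdb -[flatten _]/(wfact f ++ flatten (map wfact db)) -catA. Qed.

Lemma holds_at_wdb db p : is_first (nth None (wdb db) p) ->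
  exists2 f, f \in db & holds_at (wdb db) p f.
Proof.
elim: db p => [|f db IH] p; first by case: p => [|[|p]].
rewrite wdb_cons nth_cat; case: ltnP => [lt|le] fst_p; last first.
  have [g gdb hg] := IH _ fst_p; exists g; first by rewrite inE gdb orbT.
  by rewrite /holds_at drop_cat ltnNge le.
exists f; first exact: mem_head.
suff -> : p = size (whead f.1).
  by rewrite /holds_at /wfact -!catA drop_size_cat //; apply/prefixP; exists (wdb db); rewrite -catA.
have all_not (s : seq label) j : all (predC is_first) s -> is_first (nth None s j) -> False.
  move=> al fj; case: (ltnP j (size s)) => hj.
    by have := all_nthP None al j hj; rewrite /= fj.
  by rewrite nth_default in fj.
move: fst_p; rewrite /wfact nth_cat; case: ltnP => [_ fp|le fp].
  by case: (all_not (whead f.1) p) => //=; apply: wnat_not_first.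
case: (ltngtP p (size (whead f.1))) => // gt; first by rewrite ltnNge le in gt.
move: fp; rewrite -[p - _]prednK ?subn_gt0 //.
case: (f.2) => [|a l] /= fp; first by case: (_.-1) fp.
case: (all_not ((wnat a ++ wargs (rname f.1) false l) ++ [:: raw false]) _ _ fp).
by rewrite all_cat (all_cat _ (wnat a)) wargs_not_first wnat_not_first.
Qed.

Lemma wdb_holds_at db f : f \in db -> exists2 p, p < size (wdb db) & holds_at (wdb db) p f.
Proof.
elim: db => // g db IH; rewrite inE => /orP[/eqP->|/IH[p lt h]]; rewrite wdb_cons.
  exists (size (whead g.1)); first by rewrite /wfact !size_cat /=; lia.
  by rewrite /holds_at /wfact -!catA drop_size_cat //; apply/prefixP; exists (wdb db); rewrite -catA.
exists (size (wfact g) + p); first by rewrite size_cat ltn_add2l.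
by rewrite /holds_at drop_cat ifN ?addKn // -leqNgt leq_addr.
Qed.

Definition args_at (lab : seq label) p r b l :=
  exists rest, drop p lab = wargs r b l ++ raw false :: rest.

Lemma holds_args lab p f : holds_at lab p f -> args_at lab p (rname f.1) true f.2.
Proof. by move=> /prefixP[rest e]; exists rest; rewrite e -catA. Qed.

Lemma next_args lab p r b a a' l : args_at lab p r b [:: a, a' & l] ->
  args_at lab (next_arg lab p) r false (a' :: l).
Proof.
move=> [rest e]; exists rest.
have e1 : drop p.+1 lab = wnat a ++ wargs r false (a' :: l) ++ raw false :: rest.
  by rewrite -addn1 addnC -drop_drop e /= drop0 -catA.
rewrite /next_arg /nxt e1 find_cat has_find.
have no : has (@starts_arg k) (wnat a) = false.
  by apply: negbTE; rewrite -all_predC wnat_no_arg.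
rewrite -has_find no /= addn0 addnC -drop_drop e1 drop_size_cat //.
Qed.

Lemma same_upto_raw x y u v :
  same_upto (None : label) (map raw x ++ None :: u) (map raw y ++ None :: v) = (x == y).
Proof.
elim: x y => [|a x IH] [|b y] //=; rewrite ?eqxx // IH eqseq_cons.
by congr (_ && _); case: a b => [] [].
Qed.

Lemma digits_inj : injective digits.
Proof.
move=> n n' eq; apply: bits_inj; move: eq; rewrite /digits.
by elim: (bits n) (bits n') => [|b x IH] [|c y] //= [-> /IH ->].
Qed.

Lemma same_args lab p q r b a l r' b' a' l' :
  args_at lab p r b (a :: l) -> args_at lab q r' b' (a' :: l') ->
  same_arg lab p q = (a == a').
Proof.
move=> [rest e] [rest' e']; rewrite /same_arg.
have -> : drop p.+1 lab = behead (drop p lab) by rewrite -addn1 addnC -drop_drop drop1.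
have -> : drop q.+1 lab = behead (drop q lab) by rewrite -addn1 addnC -drop_drop drop1.
rewrite e e' /= /wnat -!catA /= same_upto_raw.
exact: inj_eq digits_inj _ _.
Qed.

Lemma rname_inj i j : i <= k -> j <= k -> (rname i == rname j) = (i == j).
Proof.
move=> li lj; apply/eqP/eqP => [|-> //].
have lb n : n <= k -> size (bits n) <= k by apply: leq_trans (size_bits n).
by move=> /(congr1 (@bseqval _ _)); rewrite !val_insub_bseq ?lb // => /bits_inj.
Qed.

Lemma is_rel_holds lab p f i : f.1 <= k -> i <= k -> f.2 != [::] ->
  holds_at lab p f -> is_rel i lab p = (f.1 == i).
Proof.
move=> lf li; case E : (f.2) => [//|a l] _ /holds_args[rest e]; rewrite E in e.
have lt : p < size lab.
  by rewrite ltnNge; apply/negP => /drop_oversize h; rewrite h in e.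
have := drop_nth (None : label) lt; rewrite e /= => -[en _].
by rewrite /is_rel lt -en -(rname_inj lf li); apply/eqP/eqP => [[->]|->].
Qed.
End Parse.

(** * A criterion for certainty *)

Section Graph.
Variable k : nat.
Hypothesis k2 : 2 <= k.

(* A fact R_i(a, b) with i > 0 is an edge from the vertex (i, a) to the vertex
   (i mod k + 1, b). *)
Definition arg0 (f : fact) := nth 0 f.2 0.
Definition arg1 (f : fact) := nth 0 f.2 1.
Definition source (f : fact) := (f.1, arg0 f).
Definition edge (f : fact) := f.1 != 0.
Definition link (f g : fact) := edge f && (source g == ((f.1 %% k).+1, arg1 f)).

Lemma link_edge f g : link f g -> edge g.
Proof. by move=> /andP[_ /eqP[e _]]; rewrite /edge e. Qed.

Lemma link_source f g h : source g = source h -> link f g = link f h.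
Proof. by rewrite /link => ->. Qed.

Lemma link_fun f g h : link f g -> link f h -> source g = source h.
Proof. by move=> /andP[_ /eqP->] /andP[_ /eqP->]. Qed.

Variable db : seq fact.
Hypothesis wt : well_typed (AC_sig k) (AC_rels k) db.
Local Notation sg := (AC_sig k).

(* [gs] continues [g] to a path of length k; a return path from its end to the
   source of [g] that avoids the sources of [gs] closes an elementary cycle. *)
Definition escape (g : fact) := exists gs p,
  [/\ size gs = k.-1, all (mem db) (gs ++ p), path link g (gs ++ p),
      all (fun z => source z \notin map source gs) p &
      link (last g (gs ++ p)) g /\
      ~~ (link (last g gs) g && ((0, map arg0 (g :: gs)) \in db))].

Definition reaches (f g : fact) :=
  exists2 p, all (mem db) p & path link f p /\ last f p = g.

(** In any repair, the walk from such a fact never stops and can only end up on a cycle of length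
    [k] whose tuple is in [S_k]. Restricting to [g.1 = 1] loses nothing, as every cycle passes
    through an [R_1]-fact. *)
Definition trapped (f : fact) := forall g, reaches f g ->
  has (link g) db /\ (g.1 = 1 -> ~ escape g).

Lemma wt_rel f : f \in db -> f.1 <= k.
Proof. by move=> /wt[]; rewrite mem_iota /=; lia. Qed.

Lemma wt_edge f : f \in db -> edge f -> f = (f.1, [:: arg0 f; arg1 f]).
Proof.
move=> /wt[_]; rewrite /AC_sig /edge; case: f => r [|a [|b [|c l]]]; case: eqP => //=.
Qed.

Lemma wt_S f : f \in db -> ~~ edge f -> size f.2 = k.
Proof. by move=> /wt[_]; rewrite /AC_sig /edge; case: eqP. Qed.

Lemma key_equal_edge f g : f \in db -> g \in db -> edge f ->
  key_equal sg f g = (source f == source g).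
Proof.
move=> fdb gdb ef; rewrite /key_equal /source xpair_eqE.
case: eqP => //= e; have eg : edge g by rewrite /edge -e.
rewrite [in LHS](wt_edge fdb ef) [in LHS](wt_edge gdb eg) /AC_sig /=.
by rewrite -e (negPf (ef : f.1 != 0)) /= eqseq_cons andbT.
Qed.

Lemma key_equal_S f g : f \in db -> g \in db -> ~~ edge f -> key_equal sg f g -> f = g.
Proof.
move=> fdb gdb nf /andP[/eqP e]; rewrite /AC_sig -e.
have f0 : f.1 = 0 by apply/eqP; rewrite -[_ == _]negbK.
have ng : ~~ edge g by rewrite /edge -e f0.
rewrite f0 /= !take_oversize ?(wt_S fdb) ?(wt_S gdb) // => /eqP e2.
by apply/eqP; case: (f) (g) e e2 => [? ?] [? ?] /= -> ->.
Qed.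

Lemma link_nth n g gs : 0 < g.1 -> path link g gs -> n < size gs ->
  (nth g gs n).1 = ((g.1 + n) %% k).+1.
Proof.
move=> g0; elim/last_ind: gs n => // gs h IH n; rewrite rcons_path size_rcons ltnS.
move=> /andP[pth lk]; rewrite leq_eqVlt nth_rcons => /orP[/eqP->|lt]; last by rewrite lt IH.
rewrite ltnn eqxx; move/andP: lk => [_ /eqP[-> _]].
case/lastP: gs IH pth => [|gs h'] IH pth /=; first by rewrite addn0.
have := IH (size gs) pth; rewrite last_rcons !size_rcons nth_rcons ltnn eqxx => -> //.
by congr _.+1; rewrite -[(_ %% k).+1]addn1 modnDml -addnA addn1.
Qed.

(** * A trapped fact forces every repair to satisfy the query *)

Section Certain.
Variables (r : seq fact) (f0 : fact).
Hypotheses (rep : repair sg db r) (f0db : f0 \in db) (f0e : edge f0) (tr : trapped f0).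

Lemma repair_sub f : f \in r -> f \in db.
Proof. by case: rep => h _ _; apply: h. Qed.

Lemma repair_block f : f \in db -> exists2 h, h \in r & key_equal sg f h.
Proof.
move=> fdb; case: rep => sub con mx; apply/hasP; apply: contraT => no.
have no' h : h \in r -> key_equal sg f h = false.
  by move=> hr; apply: contraNF no => e; apply/hasP; exists h.
have sym g h : key_equal sg g h -> key_equal sg h g.
  by rewrite /key_equal => /andP[/eqP-> /eqP->]; rewrite !eqxx.
suff fr : f \in r by rewrite -(no' f fr) /key_equal !eqxx.
apply: (mx (f :: r)) (mem_head _ _).
- by move=> x xr; rewrite inE xr orbT.
- by move=> x; rewrite inE => /orP[/eqP->|/sub].
move=> x y; rewrite !inE => /orP[/eqP->|xr] /orP[/eqP->|yr] //.
- by rewrite no'.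
- by move/sym; rewrite no'.
- exact: con.
Qed.

Lemma repair_S f : f \in db -> ~~ edge f -> f \in r.
Proof.
move=> fdb nf; have [h hr e] := repair_block fdb.
by rewrite (key_equal_S fdb (repair_sub hr) nf e).
Qed.

Lemma repair_source f g : f \in r -> g \in r -> edge f -> source f = source g -> f = g.
Proof.
move=> fr gr fe e; case: rep => _ con _; apply: con => //.
by rewrite key_equal_edge ?repair_sub // e.
Qed.

Definition succ (g : fact) := nth g r (find (link g) r).

Lemma reaches_step g h : reaches f0 g -> h \in db -> link g h -> reaches f0 h.
Proof.
move=> [p al [pth la]] hdb gh; exists (rcons p h); first by rewrite all_rcons /= hdb.
by rewrite rcons_path pth la gh last_rcons.
Qed.

Lemma succP g : reaches f0 g -> [/\ succ g \in r, link g (succ g) & reaches f0 (succ g)].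
Proof.
move=> rg; have [/hasP[h hdb gh] _] := tr rg.
have hs : has (link g) r.
  have [h' h'r e] := repair_block hdb; apply/hasP; exists h' => //.
  rewrite (key_equal_edge hdb (repair_sub h'r) (link_edge gh)) in e.
  by rewrite -(link_source g (eqP e)).
have lk : link g (succ g) by apply: nth_find.
have sr : succ g \in r by rewrite mem_nth // -has_find.
by split=> //; apply: reaches_step lk => //; apply: repair_sub.
Qed.

Lemma iter_succ x n : x \in r -> reaches f0 x ->
  iter n succ x \in r /\ reaches f0 (iter n succ x).
Proof. by move=> xr rx; elim: n => //= n [_ /succP[]]. Qed.

Lemma link_succ x n : x \in r -> reaches f0 x -> link (iter n succ x) (iter n.+1 succ x).
Proof. by move=> xr rx; have [_ /succP[]] := iter_succ n xr rx. Qed.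

Lemma path_traject_succ x n : x \in r -> reaches f0 x -> path link x (traject succ (succ x) n).
Proof.
elim: n x => //= n IH x xr rx; have [sr lk rs] := succP rx.
by rewrite lk IH.
Qed.

Lemma type_iter x n : x \in r -> reaches f0 x -> edge x ->
  (iter n succ x).1 = ((x.1.-1 + n) %% k).+1.
Proof.
move=> xr rx; rewrite /edge -lt0n => x0; have le := wt_rel (repair_sub xr).
case: n => [|n]; first by rewrite addn0 modn_small ?prednK //; lia.
have := @link_nth n x _ x0 (path_traject_succ n.+1 xr rx).
rewrite size_traject => /(_ (leqnn _)) h.
have -> : iter n.+1 succ x = nth x (traject succ (succ x) n.+1) n.
  by rewrite (set_nth_default (succ x)) ?size_traject // nth_traject // -iterSr.
by rewrite h -addSnnS prednK.
Qed.

Lemma periodic : exists x m, [/\ x \in r, reaches f0 x, x.1 = 1, 0 < m & iter m succ x = x].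
Proof.
have [x0r _ x0re] := @succP f0 (ex_intro2 _ _ [::] isT (conj erefl erefl)).
set x0 := succ f0 in x0r x0re.
have /trajectP[i lti e] : iter (size r) succ x0 \in traject succ x0 (size r).
  rewrite -[_ \in _]/(looping succ x0 (size r)).
  apply: contraT; rewrite -looping_uniq => uq.
  have := @uniq_leq_size _ _ r uq; rewrite size_traject ltnn => h.
  by apply: h => y /trajectP[i _ ->]; have [] := iter_succ i x0r x0re.
have [yr yre] := iter_succ i x0r x0re; set y := iter i succ x0 in e yr yre.
have ye : edge y.
  rewrite /y; case: (i) => [|j]; last exact: link_edge (link_succ j x0r x0re).
  by have [_ /link_edge] := @succP f0 (ex_intro2 _ _ [::] isT (conj erefl erefl)).
have per : iter (size r - i) succ y = y by rewrite /y -iterD subnK // ltnW.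
(* The number of steps that takes the relation index from [y.1] past [k] to 1, so that the cycle is
   entered at an [R_1]-fact. *)
have [zr zre] := iter_succ (k.+1 - y.1) yr yre.
exists (iter (k.+1 - y.1) succ y), (size r - i); split=> //; last 1 first.
- by rewrite -iterD addnC iterD per.
- rewrite type_iter //; have := wt_rel (repair_sub yr).
  have : 0 < y.1 by rewrite lt0n.
  case: (y.1) => // t _ ltk; have -> : t.+1.-1 + (k.+1 - t.+1) = k by lia.
  by rewrite modnn.
- by rewrite subn_gt0.
Qed.

Lemma last_traject_succ x n : last x (traject succ (succ x) n) = iter n succ x.
Proof. by elim: n x => // n IH x; rewrite iterSr -IH. Qed.

(** The walk inside the repair becomes periodic. Split the cycle into [z], the next [k.-1] facts and
    the rest: if these did not form an instance of the query, they would be an escape reachable from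
    [f0]. *)
Lemma trapped_satisfies : satisfies r (ACq k).
Proof.
have [z [m0 [zr zre z1 m0_gt per0]]] := periodic.
have ex : exists m, (0 < m) && (iter m succ z == z) by exists m0; rewrite m0_gt per0 eqxx.
(* Minimality of the period makes the cycle elementary, so that the rest of the cycle avoids the
   sources of [gs]. *)
case: (ex_minnP ex) => m /andP[mgt /eqP per] mmin.
have ze : edge z by rewrite /edge z1.
(* The relation index returns to 1 after [m] steps, so [k] divides [m]. *)
have km : k <= m.
  have := type_iter m zr zre ze; rewrite per z1 /= add0n => -[/esym/eqP h].
  exact: dvdn_leq h.
pose gs := traject succ (succ z) k.-1.
have lastgs : last z gs = iter k.-1 succ z by apply: last_traject_succ.
pose p := traject succ (iter k succ z) (m - k).
have catE : gs ++ p = traject succ (succ z) m.-1.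
  have -> : m.-1 = k.-1 + (m - k) by lia.
  rewrite trajectD /gs /p -iterSr; congr (_ ++ traject _ (iter _ _ _) _); lia.
have memr y : y \in gs ++ p -> exists2 i, i < m.-1 & y = iter i.+1 succ z.
  by rewrite catE => /trajectP[i lt ->]; exists i; rewrite // -iterSr.
have inj i j : j < i < m -> iter i succ z <> iter j succ z.
  move=> /andP[ji im] e.
  have : (0 < m - i + j) && (iter (m - i + j) succ z == z).
    by rewrite iterD -e -iterD subnK ?per ?eqxx; lia.
  by move/mmin; lia.
have lkS : link (last z gs) z && ((0, map arg0 (z :: gs)) \in db).
  apply: contraT => no; case: (tr zre) => _ /(_ z1) []; exists gs, p; split.
  - by rewrite size_traject.
  - apply/allP => y /memr[i _ ->]; apply: repair_sub.
    by have [] := iter_succ i.+1 zr zre.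
  - by rewrite catE path_traject_succ.
  - apply/allP => y /trajectP[i lti ->]; apply/negP => /mapP[w /trajectP[j ltj ->]].
    rewrite -iterD -iterSr => e.
    have [yr yre] := iter_succ (i + k) zr zre; have [wr _] := iter_succ j.+1 zr zre.
    have ye : edge (iter (i + k) succ z).
      by have -> : i + k = (i + k).-1.+1 by [lia]; apply: link_edge (link_succ _ zr zre).
    by apply: (@inj (i + k) j.+1) (repair_source yr wr ye e); lia.
  - split=> //; rewrite catE last_traject_succ.
    by rewrite -{2}per -{2}(prednK mgt) link_succ.
case/andP: lkS => lk Sdb.
have Sr := repair_S Sdb isT.
have gsE : z :: gs = traject succ z k by rewrite -[in RHS](prednK (ltnW k2)).
pose v i := arg0 (iter i.-1 succ z).
have nthE i : 1 <= i <= k -> (i, [:: v i; v (i %% k).+1]) = iter i.-1 succ z.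
  move=> hi; have [xr xre] := iter_succ i.-1 zr zre.
  have tx : (iter i.-1 succ z).1 = i.
    by rewrite type_iter // z1 add0n modn_small; lia.
  have xe : edge (iter i.-1 succ z) by rewrite /edge tx; lia.
  rewrite [RHS](wt_edge (repair_sub xr) xe) tx; congr (_, [:: _; _]).
  case: (ltnP i k) => ik.
    rewrite modn_small // /v /=; have := link_succ i.-1 zr zre.
    by rewrite prednK; [case/andP => _ /eqP[_ ->] | lia].
  have -> : i = k by lia.
  by rewrite modnn /v /=; move: lk; rewrite lastgs => /andP[_ /eqP[_ ->]].
exists v => a; rewrite /ACq inE => /orP[/eqP->|/mapP[i]] /=.
  have <- : map arg0 (z :: gs) = map v (iota 1 k) => //.
  apply: (@eq_from_nth _ 0); first by rewrite gsE !size_map size_traject size_iota.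
  rewrite gsE size_map size_traject => i lti.
  by rewrite (nth_map z) ?size_traject // nth_traject // (nth_map 0) ?size_iota // nth_iota.
rewrite mem_iota => hi -> /=; rewrite nthE; last by lia.
by have [] := iter_succ i.-1 zr zre.
Qed.

End Certain.
End Graph.

(** * Construction of a falsifying repair *)

Section Falsify.
Variable k : nat.
Hypothesis k2 : 2 <= k.
Local Notation link := (link k).
Variable db : seq fact.
Hypothesis wt : well_typed (AC_sig k) (AC_rels k) db.
Local Notation sg := (AC_sig k).

Definition qfact (v : nat -> nat) i : fact := (i, [:: v i; v (i %% k).+1]).
Definition chooses (r0 : seq fact) :=
  forall f g, f \in r0 -> g \in r0 -> source f = source g -> f = g.
Definition falsifies (r0 : seq fact) := forall v,
  (forall i, 0 < i <= k -> qfact v i \in r0) -> (0, map v (iota 1 k)) \notin db.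
Definition covered (r0 : seq fact) f := source f \in map source r0.

(* A choice of outgoing edges on a set of vertices from which only that set and
   dead ends can be reached. *)
Definition safe (r0 : seq fact) :=
  [/\ {subset r0 <= db}, all edge r0, chooses r0,
      forall e, e \in r0 -> has (link e) db -> has (link e) r0 & falsifies r0].

Lemma qfact_link v i : 0 < i -> link (qfact v i) (qfact v (i %% k).+1).
Proof. by move=> i0; rewrite /link /edge /= -lt0n i0 eqxx. Qed.

Lemma qfact_pred i : 0 < i <= k -> exists2 j, 0 < j <= k & (j %% k).+1 = i.
Proof.
move=> hi; case: (ltngtP i 1) => [|gt|->]; first by lia.
  by exists i.-1; [lia | rewrite modn_small; lia].
by exists k; [lia | rewrite modnn].
Qed.

(** Propagation runs backwards because a safe set is closed under successors: a query fact that
    leads to an uncovered fact cannot lie in the safe set, so it belongs to the newly added part. *)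
Lemma cyclic_ind (P : nat -> Prop) :
  (forall i, 0 < i <= k -> P (i %% k).+1 -> P i) ->
  forall i j, 0 < i <= k -> 0 < j <= k -> P i -> P j.
Proof.
move=> back; have down j d : 0 < j -> j + d <= k -> P (j + d) -> P j.
  elim: d j => [|d IH] j j0 le; first by rewrite addn0.
  rewrite addnS -addSn => h; apply: back; first by lia.
  by rewrite modn_small; [apply: IH h; lia | lia].
move=> i j hi hj Pi; have P1 : P 1.
  by apply: (down 1 i.-1) => //; rewrite add1n prednK //; lia.
have Pk : P k by apply: back; [lia | rewrite modnn].
by apply: (down j (k - j)); rewrite ?subnKC //; lia.
Qed.

Lemma modk_range i : 0 < i <= k -> 0 < (i %% k).+1 <= k.
Proof. by move=> _; rewrite ltn_pmod; lia. Qed.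

Lemma range1 : 0 < 1 <= k. Proof. by lia. Qed.

Lemma last_iotaS a n : last a (iota a.+1 n) = a + n.
Proof. by elim: n a => [|n IH] a; rewrite ?addn0 //= IH addnS. Qed.

Lemma coveredP r0 f : reflect (exists2 g, g \in r0 & source g = source f) (covered r0 f).
Proof. by apply: (iffP mapP) => -[g h e]; exists g. Qed.

Lemma link_covered r0 e f : safe r0 -> e \in r0 -> f \in db -> link e f -> covered r0 f.
Proof.
move=> [_ _ _ cl _] er fdb ef.
have /(cl e er)/hasP[g gr eg] : has (link e) db by apply/hasP; exists f.
by apply/coveredP; exists g => //; apply: link_fun eg ef.
Qed.

Lemma covered_link r0 e f : covered r0 f -> link e f -> has (link e) r0.
Proof.
by move=> /coveredP[g gr eq] ef; apply/hasP; exists g => //; rewrite (link_source _ _ eq).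
Qed.

Lemma uniq_source C : uniq (map source C) -> chooses C.
Proof.
elim: C => // x C IH /= /andP[xC /IH h] f g; rewrite !inE.
move=> /orP[/eqP->|fC] /orP[/eqP->|gC] e //; last exact: h.
- by rewrite e map_f in xC.
- by rewrite -e map_f in xC.
Qed.

Lemma chooses_cat C r0 : chooses C -> chooses r0 ->
  (forall e, e \in C -> ~~ covered r0 e) -> chooses (C ++ r0).
Proof.
move=> hC hr dis f g; rewrite !mem_cat => /orP[fC|fr] /orP[gC|gr] e.
- exact: hC.
- by have := dis f fC; case/coveredP; exists g.
- by have := dis g gC; case/coveredP; exists f.
- exact: hr.
Qed.

(** No instance of the query goes through [e]: the fact before it would lie in [r0], whose
    successors are all covered, while [e] is not. As [k >= 2], that fact is not [e] itself. *)
Lemma safe_add r0 e : safe r0 -> e \in db -> edge e -> ~~ covered r0 e ->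
  ~~ has (link e) db || has (link e) r0 -> safe (e :: r0).
Proof.
move=> sf edb ee nc out; have [sub ed con cl fal] := sf; split.
- by move=> x; rewrite inE => /orP[/eqP->|/sub].
- by rewrite /= ee.
- apply: (@chooses_cat [:: e]) => //; last by move=> x; rewrite inE => /eqP->.
  by move=> x y; rewrite !inE => /eqP-> /eqP->.
- move=> x; rewrite inE => /orP[/eqP-> h|xr h]; last by rewrite /= cl ?orbT.
  by move: out; rewrite h /= => ->; rewrite orbT.
move=> v hv; apply: fal => i hi; have := hv i hi; rewrite inE => /orP[/eqP eq|//].
have [j hj ji] := qfact_pred hi; have [j0 _] := andP hj; have := qfact_link v j0; rewrite ji eq => lk.
have := hv j hj; rewrite inE => /orP[/eqP eq'|jr].
  have : j = i by have := congr1 fst eq'; rewrite -eq.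
  move=> eji; move: ji; rewrite eji; case: (ltngtP i k) => ik; first by rewrite modn_small; lia.
    by lia.
  by rewrite ik modnn; lia.
by case/negP: nc; apply: link_covered jr edb lk.
Qed.

Lemma link_closed (C E : seq fact) x p : {subset p <= C} -> chooses C ->
  {subset E <= C} -> (forall e, e \in E -> has (link e) E) ->
  x \in E -> path link x p -> {subset p <= E}.
Proof.
move=> sub con EC clE; elim: p x sub => //= y p IH x sub xE /andP[xy pth].
have yE : y \in E.
  have /hasP[z zE xz] := clE x xE.
  have -> : y = z; last by [].
  by apply: con; [apply: sub; rewrite mem_head | apply: EC | apply: link_fun xy xz].
move=> z; rewrite inE => /orP[/eqP->//|zp].
by apply: (IH y) => // w wp; apply: sub; rewrite inE wp orbT.
Qed.

Lemma qfact_path (C : seq fact) v i gs : chooses C -> {subset gs <= C} ->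
  (forall j, 0 < j <= k -> qfact v j \in C) ->
  0 < i -> i + size gs <= k -> path link (qfact v i) gs ->
  gs = map (qfact v) (iota i.+1 (size gs)).
Proof.
move=> con; elim: gs i => //= y gs IH i sub hv i0 le /andP[ly pth].
have ey : y = qfact v i.+1.
  apply: con; [by apply: sub; rewrite mem_head | by apply: hv; lia |].
  apply: link_fun ly _; have := qfact_link v i0.
  by rewrite modn_small //; lia.
rewrite ey in pth *; congr (_ :: _); apply: (IH i.+1) => //; last by lia.
by move=> z zg; apply: sub; rewrite inE zg orbT.
Qed.

(** An instance of the query cannot mix the cycle with [r0], so it would lie entirely on the new
    cycle and exhaust it. Then [g :: gs] is the whole instance, which [bad] excludes. *)
Lemma safe_cycle r0 g gs p : safe r0 -> size gs = k.-1 -> g.1 = 1 ->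
  {subset g :: gs ++ p <= db} -> path link g (gs ++ p) -> link (last g (gs ++ p)) g ->
  uniq (map source (g :: gs ++ p)) ->
  ~~ (link (last g gs) g && ((0, map arg0 (g :: gs)) \in db)) ->
  (forall e, e \in g :: gs ++ p -> ~~ covered r0 e) -> safe ((g :: gs ++ p) ++ r0).
Proof.
move=> sf szg g1 Cdb pth lkl uq bad dis; set C := g :: gs ++ p in Cdb uq dis *.
have [sub ed con cl fal] := sf.
have conC := uniq_source uq.
have cyc : cycle link C by rewrite /C /cycle rcons_path pth.
have cyclk x : x \in C -> exists2 y, y \in C & link x y.
  by move=> xC; exists (next C x); [rewrite mem_next | apply: next_cycle].
have edC : all edge C.
  by apply/allP => x xC; have [y _ /andP[]] := cyclk x xC.
split.
- by move=> x; rewrite mem_cat => /orP[/Cdb|/sub].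
- by rewrite all_cat edC.
- exact: chooses_cat.
- move=> x; rewrite mem_cat has_cat => /orP[/cyclk[y yC xy] _|xr h].
    by apply/orP; left; apply/hasP; exists y.
  by rewrite cl ?orbT.
move=> v hv; apply/negP => Sdb.
have back i : 0 < i <= k -> qfact v (i %% k).+1 \in C -> qfact v i \in C.
  move=> hi hC; have := hv i hi; rewrite mem_cat => /orP[//|ir].
  case/negP: (dis _ hC); apply: link_covered ir (Cdb _ hC) _ => //.
  by apply: qfact_link; case/andP: hi.
have all_in : forall i, 0 < i <= k -> qfact v i \in C.
  have [[i hi iC]|no] := classic (exists2 i, 0 < i <= k & qfact v i \in C); last first.
    have /fal : forall i, 0 < i <= k -> qfact v i \in r0.
      move=> i hi; have := hv i hi; rewrite mem_cat => /orP[iC|//].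
      by case: no; exists i.
    by rewrite Sdb.
  by move=> j hj; apply: (@cyclic_ind (fun i => qfact v i \in C)) iC.
set E := map (qfact v) (iota 1 k).
have EP e : e \in E -> exists2 i, 0 < i <= k & e = qfact v i.
  by move=> /mapP[i]; rewrite mem_iota add1n ltnS => hi ->; exists i.
have inE_ i : 0 < i <= k -> qfact v i \in E.
  by move=> hi; apply: map_f; rewrite mem_iota add1n ltnS.
have EC : {subset E <= C} by move=> e /EP[i hi ->]; apply: all_in.
have clE e : e \in E -> has (link e) E.
  move=> /EP[i hi ->]; apply/hasP; exists (qfact v (i %% k).+1).
    exact/inE_/modk_range.
  by apply: qfact_link; case/andP: hi.
(* [E] is closed under successors and the cycle [C] chooses only one fact per source; going round
   [C] from [qfact v 1] thus stays in [E] and meets [g]. *)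
have gE : g \in E.
  have C1 : qfact v 1 \in C := all_in 1 range1.
  case/rot_to: (C1) => i s rotE.
  have : cycle link (qfact v 1 :: s) by rewrite -rotE rot_cycle.
  rewrite /cycle rcons_path => /andP[ps _].
  have sE : {subset s <= E}.
    apply: (@link_closed C E (qfact v 1)) => //; last exact: inE_ range1.
    by move=> x xs; rewrite -(mem_rot i) rotE inE xs orbT.
  have : g \in rot i C by rewrite mem_rot mem_head.
  by rewrite rotE inE => /orP[/eqP->|/sE//]; apply: inE_ range1.
have ge : g = qfact v 1 by have [i _ ei] := EP _ gE; move: g1; rewrite ei /= => ->.
have gsE : gs = map (qfact v) (iota 2 (size gs)).
  apply: (@qfact_path C v 1) => //; last 1 first.
  - by rewrite -ge; move: pth; rewrite cat_path => /andP[].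
  - by move=> x xg; rewrite inE mem_cat xg orbT.
  - by rewrite szg add1n prednK // ltnW.
have ggs : g :: gs = map (qfact v) (iota 1 k).
  by rewrite ge gsE szg -[in RHS](prednK (ltnW k2)).
case/negP: bad; apply/andP; split; last first.
  by rewrite ggs -map_comp.
have -> : last g gs = qfact v k.
  by rewrite ge gsE last_map last_iotaS szg add1n prednK // ltnW.
by rewrite ge; have := @qfact_link v k; rewrite modnn; apply; apply: ltnW.
Qed.

(** Loop removal up to equality of sources: a fact that links to [a] links to every fact with the
    source of [a], so it can jump directly to a later one, or close at [y]. *)
Lemma source_path x p y : path link x p -> link (last x p) y -> exists p',
  [/\ {subset p' <= p}, path link x p', link (last x p') y & uniq (map source (y :: p'))].
Proof.
elim: p x => [|a p IH] x /=; first by move=> _ xy; exists [::].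
move=> /andP[xa pth] lk; have [p' [sub pth' lk' uq]] := IH a pth lk.
have [eqy|ney] := eqVneq (source a) (source y).
  by exists [::]; split=> //=; rewrite -(link_source _ _ eqy).
have [/mapP[b bp e]|na] := boolP (source a \in map source p'); last first.
  exists (a :: p'); split=> //=; first by move=> z; rewrite !inE => /orP[->//|/sub ->]; rewrite orbT.
  - by rewrite xa.
  - by move: uq => /= /andP[ny ->]; rewrite inE negb_or eq_sym ney ny na.
case/splitPr: bp sub pth' lk' uq => u w sub pth' lk' uq.
move: pth'; rewrite cat_path /= => /and3P[_ _ pw].
exists (b :: w); split=> /=.
- move=> z zb; rewrite inE; apply/orP; right; apply: sub.
  by rewrite mem_cat zb orbT.
- by rewrite -(link_source _ _ e) xa.
- by move: lk'; rewrite last_cat.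
- move: uq; rewrite /= map_cat cat_uniq mem_cat negb_or /= => /andP[/andP[_ ny] /and3P[_ _ /andP[nb uw]]].
  by rewrite ny nb uw.
Qed.

Lemma path_edge f p : edge f -> path link f p -> all edge p.
Proof. by elim: p f => //= g p IH f ef /andP[/link_edge eg /(IH _ eg) ->]; rewrite eg. Qed.

(** Either the path stays outside the covered region, or it has a last uncovered fact before
    entering it; the latter can be added by [safe_add]. *)
Lemma walk r0 f p : edge f -> path link f p -> ~~ covered r0 f ->
  (exists e, [/\ e \in f :: p, edge e, ~~ covered r0 e & has (link e) r0])
  \/ (forall e, e \in f :: p -> ~~ covered r0 e).
Proof.
elim: p f => [|g p IH] f ef /= pth nf; first by right=> e; rewrite inE => /eqP->.
case/andP: pth => fg pth; have [cg|ng] := boolP (covered r0 g).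
  by left; exists f; rewrite mem_head; split=> //; apply: covered_link cg fg.
case: (IH g (link_edge fg) pth ng) => [[e [ep ee ne he]]|all_n].
  by left; exists e; rewrite inE ep orbT.
by right=> e; rewrite inE => /orP[/eqP->//|/all_n].
Qed.

Lemma path_types x gs i : x.1 = i -> 0 < i -> i + size gs <= k -> path link x gs ->
  map fst (x :: gs) = iota i (size gs).+1.
Proof.
move=> xi; elim: gs x i xi => [|y gs IH] x i xi i0 /=; first by rewrite xi.
move=> le /andP[/andP[_ /eqP[ey _]] pth].
have hy : y.1 = i.+1 by rewrite ey xi modn_small //; lia.
by have := IH y i.+1 hy isT; rewrite /= xi => -> //; lia.
Qed.

(** The return walk of an escape may revisit itself or the source of [g]; [source_path] removes
    both. The sources of [g :: gs] differ already by their relation names 1 to [k]. *)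
Lemma escape_cycle g : escape k db g -> g \in db -> g.1 = 1 -> exists gs p,
  [/\ size gs = k.-1, {subset g :: gs ++ p <= db}, path link g (gs ++ p) &
   [/\ link (last g (gs ++ p)) g, uniq (map source (g :: gs ++ p)) &
   ~~ (link (last g gs) g && ((0, map arg0 (g :: gs)) \in db))]].
Proof.
move=> [gs [p [szg al pth av [lk bad]]]] gdb g1.
move: pth lk; rewrite cat_path last_cat => /andP[pg pp] lk.
have [p' [sub pth' lk' uq]] := source_path pp lk.
exists gs, p'; split=> //.
- move=> z; rewrite inE => /orP[/eqP->//|]; rewrite mem_cat => zg.
  apply: (allP al); rewrite mem_cat; case/orP: zg => [->//|/sub->]; exact: orbT.
- by rewrite cat_path pg.
split=> //; first by rewrite last_cat.
have uqg : uniq (map source (g :: gs)).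
  apply: (@map_uniq _ _ fst); rewrite -map_comp.
  have -> : map (fst \o source) (g :: gs) = map fst (g :: gs) by [].
  by rewrite (path_types g1) ?iota_uniq // szg add1n prednK // ltnW.
rewrite -cat_cons map_cat cat_uniq uqg /=.
move: uq => /= /andP[ng ->]; rewrite andbT; apply/hasPn => _ /mapP[z zp ->].
rewrite inE negb_or; apply/andP; split.
  by apply: contraNneq ng => <-; apply: map_f.
exact: (allP av _ (sub _ zp)).
Qed.

(** One fact or one cycle is added at a time, not the route from [f] to it: facts further back on
    the route are handled by later extensions, once their target is covered. *)
Lemma safe_extend r0 f : safe r0 -> f \in db -> edge f -> ~~ covered r0 f ->
  ~ trapped k db f -> exists2 r1, safe r1 &
    {subset r0 <= r1} /\ exists2 e, e \in db & [&& edge e, ~~ covered r0 e & e \in r1].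
Proof.
move=> sf fdb ef nf ntr.
have add e : e \in db -> edge e -> ~~ covered r0 e ->
    ~~ has (link e) db || has (link e) r0 -> exists2 r1, safe r1 &
    {subset r0 <= r1} /\ exists2 e, e \in db & [&& edge e, ~~ covered r0 e & e \in r1].
  move=> edb ee ne h; exists (e :: r0); first exact: safe_add.
  split; first by move=> x xr; rewrite inE xr orbT.
  by exists e; rewrite // ee ne mem_head.
have [g [[p al [pth la]] hg]] : exists g, reaches k db f g /\
    (~~ has (link g) db \/ g.1 = 1 /\ escape k db g).
  apply: NNPP => no; apply: ntr => g rg; split.
    by apply: contraT => nh; case: no; exists g; split=> //; left.
  by move=> g1 esc; case: no; exists g; split=> //; right.
have sub x : x \in f :: p -> x \in db.
  by rewrite inE => /orP[/eqP->//|/(allP al)].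
have eall x : x \in f :: p -> edge x.
  by rewrite inE => /orP[/eqP->//|/(allP (path_edge ef pth))].
have gfp : g \in f :: p by rewrite -la mem_last.
case: (walk ef pth nf) => [[e [ep ee ne he]]|all_n].
  by apply: (add e) => //; [apply: sub | rewrite he orbT].
case: hg => [dead|[g1 esc]].
  by apply: (add g); rewrite ?dead //; [apply: sub | apply: eall | apply: all_n].
have [gs [q [szg subC pthC [lk uq bad]]]] := escape_cycle esc (sub _ gfp) g1.
case: (walk (eall _ gfp) pthC (all_n _ gfp)) => [[e [ep ee ne he]]|all_C].
  by apply: (add e) => //; [apply: subC | rewrite he orbT].
exists ((g :: gs ++ q) ++ r0); first exact: safe_cycle.
split; first by move=> x xr; rewrite mem_cat xr orbT.
by exists g; [apply: sub | rewrite mem_head eall // all_C // mem_head].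
Qed.

Lemma safe_total : (forall f, f \in db -> edge f -> ~ trapped k db f) ->
  exists2 r0, safe r0 & forall f, f \in db -> edge f -> covered r0 f.
Proof.
move=> ntr; pose todo r0 := count (fun f => edge f && ~~ covered r0 f) db.
have [n] : exists n, todo [::] <= n by exists (todo [::]).
have : safe [::] by split=> // v hv; have := hv 1 range1.
elim: n [::] => [|n IH] r0 sf le.
  exists r0 => // f fdb ef; apply: contraT => nf.
  suff : 0 < todo r0 by rewrite ltnNge le.
  by rewrite -has_count; apply/hasP; exists f; rewrite // ef nf.
have [[f fdb /andP[ef nf]]|all_c] := classic (exists2 f, f \in db & edge f && ~~ covered r0 f).
  have [r1 sf1 [sub [e edb /and3P[ee ne er1]]]] := safe_extend sf fdb ef nf (ntr f fdb ef).
  apply: (IH r1 sf1); rewrite -ltnS; apply: leq_trans le.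
  have hsub : subpred (fun f => edge f && ~~ covered r1 f) (fun f => edge f && ~~ covered r0 f).
    move=> x /andP[-> nc] /=; apply: contra nc => /coveredP[y yr eq].
    by apply/coveredP; exists y => //; apply: sub.
  have he : ~~ (edge e && ~~ covered r1 e).
    by rewrite ee negbK; apply/coveredP; exists e.
  rewrite /todo; elim: (db) edb => // x s IHs; rewrite inE => /orP[/eqP <-|es] /=.
    by rewrite (negPf he) ee ne add0n add1n ltnS; apply: sub_count.
  rewrite -addnS leq_add ?IHs //.
  by have := hsub x; case: (edge x && ~~ covered r1 x) => // ->.
exists r0 => // f fdb ef; apply: contraT => nf.
by case: all_c; exists f; rewrite // ef.
Qed.

Lemma certain_trapped : certain sg (ACq k) db <->
  exists2 f, f \in db & edge f /\ trapped k db f.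
Proof.
split=> [cert|[f fdb [ef tr]] r rep]; last exact: (trapped_satisfies k2 wt rep fdb ef tr).
apply: NNPP => no.
have [|r0 [sub ed con cl fal] cov] := safe_total.
  by move=> f fdb ef tr; apply: no; exists f.
(* A repair, since [r0] meets every block of edges in one fact and every [S_k]-fact is a block of
   its own. *)
pose r := r0 ++ [seq f <- db | ~~ edge f].
have subr : {subset r <= db}.
  by move=> x; rewrite mem_cat => /orP[/sub//|]; rewrite mem_filter => /andP[].
have edr x : x \in r -> edge x -> x \in r0.
  by rewrite mem_cat => /orP[//|]; rewrite mem_filter => /andP[/negPf->].
have rep : repair sg db r.
  split=> // [x y xr yr|r' rr' sub' con' x xr'].
    have [ex|nx] := boolP (edge x); last exact: key_equal_S (subr _ xr) (subr _ yr) nx.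
    rewrite (key_equal_edge wt (subr _ xr) (subr _ yr) ex) => /eqP e; apply: con => //; apply: edr => //.
    by move: e; rewrite /edge in ex *; case=> <-.
  have xdb := sub' _ xr'; have [ex|nx] := boolP (edge x); last first.
    by rewrite mem_cat mem_filter nx xdb orbT.
  have /coveredP[y yr e] := cov x xdb ex.
  have -> : x = y; last by rewrite mem_cat yr.
  have yr' : y \in r' by apply: rr'; rewrite mem_cat yr.
  by apply: con' => //; rewrite (key_equal_edge wt xdb (sub' _ yr') ex) e.
have [v hv] := cert r rep.
have : (0, map v (iota 1 k)) \in db by apply: subr; apply: (hv (0, iota 1 k)); rewrite mem_head.
apply/negP; apply: fal => i hi; apply: edr; last by rewrite /edge /= -lt0n; case/andP: hi.
apply: (hv (i, [:: i; (i %% k).+1])); rewrite inE; apply/orP; right.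
by apply/mapP; exists i; rewrite // mem_iota add1n ltnS.
Qed.
End Falsify.

(** * Correctness of the formula *)

Section Correctness.
Variable k : nat.
Hypothesis k2 : 2 <= k.
Variable db : seq fact.
Hypothesis wt : well_typed (AC_sig k) (AC_rels k) db.
Local Notation lab := (wdb k db).
Local Notation n := (size (wdb k db)).
Local Notation link := (link k).

(** A relation and not a bijection: a fact listed twice in [db] has several positions. [fact_at] and
    [pos_of] merely pick a partner. *)
Definition at_edge p f := [/\ f \in db, edge f, p < n & holds_at lab p f].
Definition is_edge p := has (fun i => is_rel i lab p) (iota 1 k).
Definition fact_at p := nth (0, [::]) db (find (fun f => edge f && holds_at lab p f) db).
Definition pos_of f := find (fun p => holds_at lab p f) (iota 0 n).

Lemma wt_nonempty f : f \in db -> f.2 != [::].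
Proof.
move=> fdb; have [ef|nf] := boolP (edge f); first by rewrite (wt_edge wt fdb ef).
have := wt_S wt fdb nf; case: (f.2) => //= k0; by move: k2; rewrite -k0.
Qed.

Lemma is_rel_at p f i : f \in db -> i <= k -> holds_at lab p f -> is_rel i lab p = (f.1 == i).
Proof. by move=> fdb ik; apply: is_rel_holds => //; [apply: (wt_rel k2 wt fdb) | apply: wt_nonempty]. Qed.

Lemma is_rel_ex p i : i <= k -> is_rel i lab p ->
  exists2 f, f \in db & holds_at lab p f /\ f.1 = i.
Proof.
move=> ik hp; have /andP[_ /eqP e] := hp.
have [|f fdb hf] := @holds_at_wdb k db p; first by rewrite e.
by exists f => //; split=> //; apply/eqP; rewrite -(is_rel_at fdb ik hf).
Qed.

Lemma fact_atP p : is_edge p -> at_edge p (fact_at p).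
Proof.
move=> /hasP[i]; rewrite mem_iota add1n ltnS => /andP[i0 ik] hp.
have [f fdb [hf fi]] := is_rel_ex ik hp.
have h : has (fun f => edge f && holds_at lab p f) db.
  by apply/hasP; exists f; rewrite // /edge fi hf -lt0n i0.
have /andP[e1 e2] := nth_find (0, [::]) h.
by split=> //; [rewrite mem_nth -?has_find | case/andP: hp].
Qed.

Lemma pos_ofP f : f \in db -> edge f -> at_edge (pos_of f) f.
Proof.
move=> fdb ef; have [p ltp hp] := wdb_holds_at k2 fdb.
have h : has (fun p => holds_at lab p f) (iota 0 n).
  by apply/hasP; exists p; rewrite // mem_iota.
have lt : pos_of f < n by move: h; rewrite has_find size_iota.
by split=> //; have := nth_find 0 h; rewrite nth_iota.
Qed.

Lemma at_edge_is p f : at_edge p f -> is_edge p.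
Proof.
move=> [fdb ef _ hf]; have fk := wt_rel k2 wt fdb.
apply/hasP; exists f.1; first by rewrite mem_iota add1n ltnS fk lt0n (ef : f.1 != 0).
by rewrite (is_rel_at fdb fk hf).
Qed.

Lemma at_edge_args p f : at_edge p f ->
  args_at lab p (rname k f.1) true [:: arg0 f; arg1 f].
Proof.
by move=> [fdb ef _ /holds_args]; rewrite [in X in args_at _ _ _ _ X](wt_edge wt fdb ef).
Qed.

Lemma linkp_link p q f g : at_edge p f -> at_edge q g -> linkp lab p q = link f g.
Proof.
move=> pf qg; rewrite /linkp -[link f g]/(edge f && (source g == ((f.1 %% k).+1, arg1 f))) xpair_eqE.
rewrite (same_args (next_args (at_edge_args pf)) (at_edge_args qg)) [arg1 f == _]eq_sym.
have [fdb ef _ hf] := pf; have [gdb eg _ hg] := qg.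
rewrite ef /=; congr (_ && _).
apply/hasP/eqP => [[i]|e].
  rewrite mem_iota add1n ltnS => /andP[i0 ik].
  have sk : (i %% k).+1 <= k by rewrite ltn_pmod // ltnW.
  by rewrite (is_rel_at fdb ik hf) (is_rel_at gdb sk hg) => /andP[/eqP-> /eqP].
have fk := wt_rel k2 wt fdb; exists f.1; first by rewrite mem_iota add1n ltnS fk lt0n (ef : f.1 != 0).
have sk : (f.1 %% k).+1 <= k by rewrite ltn_pmod // ltnW.
by rewrite (is_rel_at fdb fk hf) (is_rel_at gdb sk hg) e !eqxx.
Qed.

Lemma linkp_edge p q : linkp lab p q -> is_edge p /\ is_edge q.
Proof.
move=> /andP[/hasP[i hi /andP[hp hq]] _]; split; first by apply/hasP; exists i.
apply/hasP; exists (i %% k).+1 => //.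
by rewrite mem_iota add1n /= ltnS ltn_pmod // ltnW.
Qed.

Lemma keqp_source p q f g : at_edge p f -> at_edge q g ->
  keqp lab p q = (source f == source g).
Proof.
move=> pf qg; rewrite /keqp /source xpair_eqE.
rewrite (same_args (at_edge_args pf) (at_edge_args qg)); congr (_ && _).
have [fdb ef _ hf] := pf; have [gdb eg _ hg] := qg.
apply/hasP/eqP => [[i]|e].
  rewrite mem_iota add1n ltnS => /andP[i0 ik].
  by rewrite (is_rel_at fdb ik hf) (is_rel_at gdb ik hg) => /andP[/eqP-> /eqP].
have fk := wt_rel k2 wt fdb; exists f.1; first by rewrite mem_iota add1n ltnS fk lt0n (ef : f.1 != 0).
by rewrite (is_rel_at fdb fk hf) (is_rel_at gdb fk hg) e !eqxx.
Qed.

Fixpoint at_edges ps fs := match ps, fs with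
  | [::], [::] => True
  | p :: ps', f :: fs' => at_edge p f /\ at_edges ps' fs'
  | _, _ => False
  end.

Lemma at_edges_fact ps : all is_edge ps -> at_edges ps (map fact_at ps).
Proof. by elim: ps => //= p ps IH /andP[/fact_atP hp /IH]. Qed.

Lemma at_edges_pos fs : all (mem db) fs -> all edge fs -> at_edges (map pos_of fs) fs.
Proof.
by elim: fs => //= f fs IH /andP[fdb al] /andP[ef /(IH al)]; split=> //; apply: pos_ofP.
Qed.

Lemma at_edges_size ps fs : at_edges ps fs -> size ps = size fs.
Proof. by elim: ps fs => [|p ps IH] [|f fs] //= [_ /IH->]. Qed.

Lemma at_edges_db ps fs : at_edges ps fs -> all (mem db) fs.
Proof. by elim: ps fs => [|p ps IH] [|f fs] //= [[-> _ _ _] /IH]. Qed.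

Lemma at_edges_lt ps fs : at_edges ps fs -> all (gtn n) ps.
Proof. by elim: ps fs => [|p ps IH] [|f fs] //= [[_ _ -> _] /IH]. Qed.

Lemma at_edges_path p f ps fs : at_edge p f -> at_edges ps fs ->
  path (linkp lab) p ps = path link f fs.
Proof.
elim: ps fs p f => [|q ps IH] [|g fs] p f //= pf [qg h].
by rewrite (linkp_link pf qg) (IH fs q g).
Qed.

Lemma at_edges_last p f ps fs : at_edge p f -> at_edges ps fs -> at_edge (last p ps) (last f fs).
Proof. by elim: ps fs p f => [|q ps IH] [|g fs] p f //= pf [qg h]; apply: IH. Qed.

Lemma at_edges_cat ps qs fs gs : at_edges ps fs -> at_edges qs gs ->
  at_edges (ps ++ qs) (fs ++ gs).
Proof. by elim: ps fs => [|q ps IH] [|g fs] //= [qg h] h'; split=> //; apply: IH. Qed.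

Lemma linkp_path_edges p ps : path (linkp lab) p ps -> all is_edge ps.
Proof. by elim: ps p => //= q ps IH p /andP[/linkp_edge[_ ->] /IH]. Qed.

Definition avoids ps b := all (fun w => ~~ keqp lab b w) ps.

Lemma avoids_source q g ps fs : at_edge q g -> at_edges ps fs ->
  avoids ps q = (source g \notin map source fs).
Proof.
move=> qg; elim: ps fs => [|p ps IH] [|f fs] //= [pf /IH e].
by rewrite inE negb_or -e (keqp_source qg pf).
Qed.

Lemma all_avoids_source qs gs ps fs : at_edges qs gs -> at_edges ps fs ->
  all (avoids ps) qs = all (fun z => source z \notin map source fs) gs.
Proof.
by move=> h h'; elim: qs gs h => [|q qs IH] [|g gs] //= [qg /IH->]; rewrite (avoids_source qg h').
Qed.

Lemma args_match_arg0 p r b l ps fs : at_edges ps fs -> size ps = size l ->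
  args_at lab p r b l -> args_match lab p ps = (l == map arg0 fs).
Proof.
elim: ps fs p r b l => [|q ps IH] [|f fs] p r b [|a l] //= [qf h] [sz] hp.
rewrite (same_args hp (at_edge_args qf)) eqseq_cons; congr (_ && _).
case: l sz hp => [|a' l] sz hp.
  by case: ps sz h {IH} => //; case: fs.
by apply: IH h sz (next_args hp).
Qed.

Lemma Sp_db ps fs : at_edges ps fs -> size ps = k ->
  Sp lab ps = ((0, map arg0 fs) \in db).
Proof.
move=> h sz; apply/hasP/idP => [[p _ /andP[hp mt]]|Sdb].
  have [f fdb [hf f0]] := is_rel_ex (leq0n k) hp.
  have szf := wt_S wt fdb (_ : ~~ edge f); rewrite /edge f0 in szf.
  have := args_match_arg0 h _ (holds_args hf); rewrite sz szf // mt => /(_ erefl)/esym/eqP e.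
  by rewrite -e -f0; case: (f) fdb.
have [p ltp hp] := wdb_holds_at k2 Sdb.
exists p; first by rewrite mem_iota.
rewrite (is_rel_at Sdb (leq0n k) hp) /=.
rewrite (args_match_arg0 h _ (holds_args hp)) //= size_map.
by rewrite (at_edges_size h).
Qed.

Definition escapep q := exists ps l,
  [/\ size ps = k.-1, all (gtn n) (ps ++ l), path (linkp lab) q (ps ++ l),
      all (avoids ps) l &
      linkp lab (last q (ps ++ l)) q /\
      ~~ (linkp lab (last q ps) q && Sp lab (q :: ps))].

(** The clauses agree one by one as soon as positions and facts correspond pointwise. The two
    directions differ only in which list is given and which one is picked. *)
Lemma escapep_escape q g : at_edge q g -> escapep q <-> escape k db g.
Proof.
move=> qg; have one ps l fs gl : at_edges ps fs -> at_edges l gl -> size ps = k.-1 ->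
  [/\ path (linkp lab) q (ps ++ l) = path link g (fs ++ gl),
      all (avoids ps) l = all (fun z => source z \notin map source fs) gl,
      linkp lab (last q (ps ++ l)) q = link (last g (fs ++ gl)) g &
      linkp lab (last q ps) q && Sp lab (q :: ps) =
      link (last g fs) g && ((0, map arg0 (g :: fs)) \in db)].
  move=> h h' sz; have h2 := at_edges_cat h h'; split.
  - exact: at_edges_path.
  - exact: all_avoids_source.
  - exact: linkp_link (at_edges_last qg h2) qg.
  - congr (_ && _); first exact: linkp_link (at_edges_last qg h) qg.
    by apply: (@Sp_db (q :: ps) (g :: fs)) => //=; rewrite sz prednK // ltnW.
split=> [[ps [l [sz al pth av [lk bad]]]]|[fs [gl [sz al pth av [lk bad]]]]].
  have := linkp_path_edges pth; rewrite all_cat => /andP[e1 e2].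
  have h1 := at_edges_fact e1; have h2 := at_edges_fact e2.
  have [r1 r2 r3 r4] := one _ _ _ _ h1 h2 sz.
  exists (map fact_at ps), (map fact_at l); rewrite -r1 -r2 -r3 -r4 size_map; split=> //.
  exact: at_edges_db (at_edges_cat h1 h2).
have eg : edge g by case: qg.
have := path_edge eg pth; move: (al); rewrite !all_cat => /andP[d1 d2] /andP[e1 e2].
have h1 := at_edges_pos d1 e1; have h2 := at_edges_pos d2 e2.
have sz' : size (map pos_of fs) = k.-1 by rewrite size_map.
have [r1 r2 r3 r4] := one _ _ _ _ h1 h2 sz'.
exists (map pos_of fs), (map pos_of gl); rewrite r1 r2 r3 r4; split=> //.
exact: at_edges_lt (at_edges_cat h1 h2).
Qed.

Lemma path_formulaP j phi s q : pos_at n s (size s).-1 = q -> 0 < size s ->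
  path_formula j phi lab s <-> exists ps,
    [/\ size ps = j, all (gtn n) ps, path (linkp lab) q ps & phi lab (s ++ map Pos ps)].
Proof.
elim: j s q => [|j IH] s q eq sz /=.
  split=> [h|[ps [/size0nil->]]]; last by rewrite cats0.
  by exists [::]; rewrite cats0.
have step p : p < n -> path_formula j phi lab (rcons s (Pos p)) <-> exists ps,
    [/\ size ps = j, all (gtn n) ps, path (linkp lab) p ps & phi lab (s ++ map Pos (p :: ps))].
  move=> ltp; rewrite (IH _ p); [|by rewrite size_rcons pos_rcons_in|by rewrite size_rcons].
  by split=> -[ps [h1 h2 h3 h4]]; exists ps; split=> //; move: h4; rewrite cat_rcons.
rewrite eq; split=> [/hasP[p]|[[|p ps] [//= [szp] /andP[ltp al] /andP[qp pth] h]]].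
  rewrite mem_iota => /= ltp /andP[qp /(step p ltp)[ps [h1 h2 h3 h4]]].
  by exists (p :: ps); rewrite /= h1 ltp qp.
apply/hasP; exists p; first by rewrite mem_iota.
by rewrite qp; apply/(step p ltp); exists ps.
Qed.

Lemma cycle_formula_pos e1 e2 q ps : q < n -> all (gtn n) ps -> size ps = k.-1 ->
  cycle_formula 2 lab [:: e1, e2, Pos q & map Pos ps] =
  ~~ (linkp lab (last q ps) q && Sp lab (q :: ps)) &&
  has (fun h => reach n (fun a b => linkp lab a b && avoids ps b) (last q ps) h
                && linkp lab h q) (iota 0 n).
Proof.
move=> ltq al sz; set s := [:: e1, e2, Pos q & map Pos ps].
have posE i : i < k -> pos_at n s i.+2 = nth q (q :: ps) i.
  move=> lti; have szq : size (q :: ps) = k by rewrite /= sz prednK // ltnW.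
  have -> : pos_at n s i.+2 = first_on n (nth (Pos 0) (map Pos (q :: ps)) i) by [].
  rewrite (nth_map q) ?szq // first_on_pos //.
  by apply: (all_nthP q (_ : all (gtn n) (q :: ps))) => //=; rewrite ?ltq // sz; lia.
have k0 : 0 < k := ltnW k2.
have mapE : [seq pos_at n s i | i <- iota 2 k] = q :: ps.
  apply: (@eq_from_nth _ q); rewrite size_map size_iota; first by rewrite /= sz prednK.
  by move=> i lti; rewrite (nth_map 0) ?size_iota // nth_iota // posE.
have mapE' : [seq pos_at n s i | i <- iota 3 k.-1] = ps.
  have e j : 0 < j -> iota 2 j = 2 :: iota 3 j.-1 by case: j.
  by move: mapE; rewrite (e k k0) /= => -[_ ->].
have lastE : pos_at n s (2 + k.-1) = last q ps.
  by rewrite posE ?ltn_predL // -sz; apply: (nth_last q (q :: ps)).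
have p2 : pos_at n s 2 = q by rewrite posE.
rewrite /cycle_formula /return_formula lastE p2 mapE; congr (_ && _).
apply: eq_has => h; congr (_ && _); apply: eq_reach => a b.
by rewrite /avoidp /avoids -[in RHS]mapE' all_map.
Qed.

Lemma path_avoids ps x l :
  path (fun a b => linkp lab a b && avoids ps b) x l =
  path (linkp lab) x l && all (avoids ps) l.
Proof.
by elim: l x => //= y l IH x; rewrite IH; case: linkp; case: avoids; rewrite ?andbF.
Qed.

Lemma path_formula_escapep e1 e2 q : q < n ->
  path_formula k.-1 (cycle_formula 2) lab [:: e1; e2; Pos q] <-> escapep q.
Proof.
move=> ltq; rewrite (@path_formulaP _ _ [:: e1; e2; Pos q] q); last by []; last first.
  by rewrite /pos_at first_on_pos.
split=> [[ps [sz al pth]]|[ps [l [sz al pth av [lk bad]]]]].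
  rewrite cycle_formula_pos // => /andP[bad /hasP[h _ /andP[/reachP[_ [l [_ all_l]]]]]].
  rewrite path_avoids => /andP[pl av] la lk.
  by exists ps, l; rewrite all_cat al all_l cat_path pth pl last_cat la; split.
move: al pth lk; rewrite all_cat cat_path last_cat => /andP[al1 al2] /andP[p1 p2] lk.
exists ps; split=> //; rewrite cycle_formula_pos // bad /=.
have lt1 x (r : seq nat) : x < n -> all (gtn n) r -> last x r < n.
  by elim: r x => //= y r IH x _ /andP[lty /IH]; apply.
apply/hasP; exists (last (last q ps) l); first by rewrite mem_iota /= !lt1.
rewrite lk andbT.
by apply: reach_path; rewrite ?lt1 // path_avoids p2 av.
Qed.

Lemma certain_formula_trapped s : certain_formula lab s <->
  exists2 f, f \in db & edge f /\ trapped k db f.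
Proof.
split=> [/hasP[p]|[f fdb [ef tr]]].
  rewrite mem_iota => /= ltp /andP[ep /hasPn safe_p]; have pf := fact_atP ep.
  have [fdb ef _ _] := pf; exists (fact_at p) => //; split=> // g [fs al [pth <-]].
  have pfs := at_edges_pos al (path_edge ef pth).
  set q := last p (map pos_of fs); have qg : at_edge q _ := at_edges_last pf pfs.
  have [_ _ ltq hg] := qg; have rq : reach n (linkp lab) p q.
    by apply: reach_path ltp (at_edges_lt pfs) _; rewrite (at_edges_path pf pfs).
  have := safe_p q; rewrite mem_iota => /(_ ltq); rewrite /lostp rq negbK.
  move=> /andP[/hasP[h _ qh] ne]; have [_ /fact_atP hh] := linkp_edge qh.
  split; first by apply/hasP; exists (fact_at h); [case: hh | rewrite -(linkp_link qg hh)].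
  move=> g1 /(escapep_escape qg) /(path_formula_escapep (Pos p) (Mark (reach n (linkp lab) p)) ltq) esc.
  have gdb : last (fact_at p) fs \in db by case: qg.
  by move: ne; rewrite (is_rel_at gdb (ltnW k2) hg) g1 eqxx esc.
have pf := pos_ofP fdb ef; have [_ _ ltp _] := pf.
apply/hasP; exists (pos_of f); first by rewrite mem_iota.
rewrite [has _ _](at_edge_is pf) /=; apply/hasPn => q _.
apply/negP => /andP[rq]; have ltq := reach_lt rq.
have /reachP[_ [l [_ all_l pl la]]] := rq.
have ll := at_edges_fact (linkp_path_edges pl); have := at_edges_last pf ll.
rewrite la; set g := last f _ => qg.
have [|/hasP[h hdb gh] ne] := tr g.
  by exists (map fact_at l); [apply: at_edges_db ll | rewrite -(at_edges_path pf ll)].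
have hh := pos_ofP hdb (link_edge gh).
have -> : has (linkp lab q) (iota 0 n).
  by apply/hasP; exists (pos_of h); [case: hh => *; rewrite mem_iota | rewrite (linkp_link qg hh)].
rewrite negbK => /andP[q1 /(path_formula_escapep _ _ ltq) esc]; apply: ne; last first.
  by apply/(escapep_escape qg).
by have [gdb _ _ hg] := qg; apply/eqP; rewrite -(is_rel_at gdb (ltnW k2) hg).
Qed.
End Correctness.

(** * Assembling the machine *)

Lemma size_scan (G : finType) Q (f : Q -> G -> Q * G) q w :
  size (scan f q w).2 = size w.
Proof. by elim: w q => //= x w IH q; case: (f q x) => p y; rewrite -(IH p); case: scan. Qed.

Lemma scan_pair (L U : finType) Q (f : Q -> L -> Q * L) (u : U) q w q' w' :
  scan f q w = (q', w') ->
  scan (fun p (g : L * U) => let: (p', l) := f p g.1 in (p', (l, g.2))) q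
    (map (fun l => (l, u)) w) = (q', map (fun l => (l, u)) w').
Proof.
elim: w q q' w' => [|x w IH] q q' w' /=; first by case=> -> <-.
case: (f q x) => p y; case E: (scan f p w) => [p1 w1] [<- <-].
by rewrite (IH _ _ _ E).
Qed.

(** The factor [2 ^ e] absorbs the passage from [n.+1] to [n] for positive [n], and the additive
    constant covers [n = 0]. *)
Lemma poly_bound T : poly T -> exists c d, forall n, T n <= c * n ^ d + c.
Proof.
move=> [c [e h]]; exists (c * 2 ^ e), e => n; apply: leq_trans (h n) _.
case: n => [|n].
  by rewrite exp1n muln1; apply: leq_trans (leq_addl _ _); rewrite leq_pmulr // expn_gt0.
apply: leq_trans (leq_addr _ _); rewrite -mulnA -expnMn leq_mul2l; apply/orP; right.
by case: e {h} => // e; rewrite leq_exp2r //; lia.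
Qed.

Section Machine.
Variables (k : nat) (m : nat) (F : frag (sym (label k) m) unit bool).

Definition blank_tracks : {ffun 'I_m.+1 -> bool} := [ffun=> false].
Definition raw_sym (b : bool) : sym (label k) m := (raw k b, blank_tracks).
Definition parser : frag (sym (label k) m) unit unit :=
  @fsweep (sym (label k) m) unit unit (pstate k)
    (fun=> (AtDb, None, insub_bseq k [::]))
    (fun p g => let: (p', l) := pstep p g.1 in (p', (l, g.2))) (fun=> tt).
Definition decider := fseq (fleft _) (fseq parser F).

Lemma raw_sym_inj : injective raw_sym.
Proof. by move=> b c []. Qed.

Lemma word_blank (lab : seq (label k)) :
  word None m lab (fun=> Mark (fun=> false)) = map (fun l => (l, blank_tracks)) lab.
Proof.
apply: (@eq_from_nth _ (None, blank_tracks)); first by rewrite size_mkseq size_map.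
rewrite size_mkseq => i lti; rewrite nth_mkseq // (nth_map None) //; congr (_, _).
Qed.
End Machine.

Theorem theorem4 (k : nat) : 2 <= k -> certainty_in_P (AC_sig k) (AC_rels k) (ACq k).
Proof.
move=> k2; set m := 3 * k + 40.
have [F [T [pT hF]]] := @dec_certain_formula k k2 m (leqnn _).
(* One step to the left, [2 * n + 4] for the parser, [T n] for the formula and two hand-overs. *)
have [c [d hcd]] : exists c d, forall n, 2 * n + T n + 7 <= c * n ^ d + c.
  by apply: poly_bound; poly_tac.
exists (tm_of (@raw_sym k m) (decider F)), c, d => db wt.
have hrel f : f \in db -> f.1 <= k by apply: wt_rel.
have [q hq] := pstep_db k2 None (insub_bseq k [::]) hrel.
(* Parsing keeps the length, so a bound in the size of the parsed word is one in the size of the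
   input. *)
have sz : size (wdb k db) = size (enc_db db).
  by have := size_scan (@pstep k) (AtDb, None, insub_bseq k [::]) (map (@raw k) (enc_db db));
     rewrite hq size_map.
have [E' [_ runF]] := hF (wdb k db) (fun=> Mark (fun=> false)).
(* The encoding ends with a bit [false], so the head initially scans an input bit and [fleft] moves
   it to the blank before the word. *)
have ne : 0 < size (enc_db db) by rewrite size_cat addn1.
case E : (enc_db db) ne hq sz => [//|x w] _ hq sz.
have rp : runs (parser k m) (tt, ([::], None, map Some (map (@raw_sym k m) (x :: w)) ++ [::]))
    (2 * size (enc_db db) + 4) (tt, wtape None m (wdb k db) (fun=> Mark (fun=> false))).
  have := @runs_sweep_gen (sym (label k) m) unit unit (pstate k)
    (fun=> (AtDb, None, insub_bseq k [::]))
    (fun p g => let: (p', l) := pstep p g.1 in (p', (l, g.2))) (fun=> tt) tt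
    (map (@raw_sym k m) (x :: w)) [::] (or_introl erefl).
  have -> : map (@raw_sym k m) (x :: w) = map (fun l => (l, blank_tracks m)) (map (@raw k) (x :: w)).
    by rewrite -map_comp.
  rewrite (scan_pair _ hq) /wtape word_blank.
  by rewrite !size_map E.
have rl := runs_left (Some (raw_sym k m x)) (map (Some \o @raw_sym k m) w).
rewrite cats0 /= -map_comp in rp.
have rn := runs_seq rl (runs_seq rp runF).
apply: (tm_of_decides (@raw_sym_inj k m) rn).
  by rewrite sz -E; apply: leq_trans (hcd _); lia.
by rewrite (certain_trapped k2 wt); apply: certain_formula_trapped.
Qed.
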